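(* Consider the finite-sum problem $\min_{\omega\in\mathbb{R}^d}F(\omega)$ and the SODDA algorithm described in the context. Suppose: (2) $F$ is strongly convex with parameter $\xi>0$; (3) there is $L\ge 1$ such that $\|\nabla f_i(x_i\omega)-\nabla f_i(x_i\hat\omega)\|\le L\|\omega-\hat\omega\|$ for all $\omega,\hat\omega\in\mathbb{R}^d$ and all $i$; (4) there is a constant $G$ such that $\frac{1}{N-1}\sum_{j=1}^N\left(\|\nabla f_j(x_j\omega^t)\|^2-\|\nabla F(\omega^t)\|^2\right)\le G^2$ for all iterates $\omega^t$; (5) there is a constant $M_2$ such that $\|\omega^t\|\le\frac{M_2}{2}$ for all $t$, and also $\|\omega^*\|\le\frac{M_2}2$. Suppose the learning rates satisfy $\sum_{t=1}^\infty\gamma_t=\infty$ and $\sum_{t=1}^\infty\gamma_t^2<\infty$, and that for some constant $\eta\ge0$ and all $t\ge0$ $$b_t\in\left[\max\left\{c_t,\ \frac{d}{1+\frac{4d\eta\gamma_{t+1}^2}{c_tM_2^2L^2}}\right\},\ d\right],\qquad c_t\le d,\qquad s_t\le N.$$ Then the sequence $\omega^t$ generated by SODDA converges almost surely to the optimal solution $\omega^*$: $$\lim_{t\to\infty}\|\omega^t-\omega^*\|=0\quad\text{a.s.}$$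
   Context: Problem. $N,d,P,Q$ are positive integers with $P\mid N$ and $QP\mid d$; put $n=N/P$, $\tilde m=d/(QP)$. Data: row vectors $x_i$ with $x_i^T\in\mathbb{R}^d$, and differentiable functions $f_i:\mathbb{R}\to\mathbb{R}$ ($f_i=\bar f(\cdot,y_i)$ for a loss $\bar f$ and label $y_i$), $i=1,\dots,N$. $F(\omega)=\frac1N\sum_{i=1}^N f_i(x_i\omega)$. $\nabla f_i(x_i\omega)\in\mathbb{R}^d$ denotes the gradient with respect to $\omega$ of $\omega\mapsto f_i(x_i\omega)$. Norms are Euclidean. It is assumed throughout that $F$ has a unique minimizer $\omega^*$. Partitioning. The $N$ observations are split into $P$ partitions of $n$ observations each; the $d$ features are split into $Q$ blocks, each further split into $P$ sub-blocks of size $\tilde m$. Accordingly $\omega=(\omega_{1,1},\dots,\omega_{1,P},\omega_{2,1},\dots,\omega_{Q,P})$ with $\omega_{q,k}\in\mathbb{R}^{\tilde m}$. For $p,k\in\{1,\dots,P\}$, $q\in\{1,\dots,Q\}$, $j\in\{1,\dots,n\}$, $x_j^{p,q,k}$ is the restriction of the $j$-th observation of observation partition $p$ to feature sub-block $(q,k)$, and $f_j^p$ is the function $f_i$ of that observation. $\nabla_{\omega_{q,k}}f_j^p(x_j^{p,q,k}\omega_{q,k})\in\mathbb{R}^{\tilde m}$ is the gradient of $\omega_{q,k}\mapsto f_j^p(x_j^{p,q,k}\omega_{q,k})$ (only the local sub-block enters the inner product). SODDA. Inputs: integer $B\ge1$ (batch size), positive learning rates $(\gamma_t)_{t\ge1}$,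 integers $1\le c_t\le b_t\le d$, $1\le s_t\le N$ for $t\ge0$. Start with $\omega^0=0$. For $t=0,1,2,\dots$: - sample $\mathcal B_t\subseteq\{1,\dots,d\}$ of size $b_t$ uniformly without replacement; sample $\mathcal C_t\subseteq\mathcal B_t$ of size $c_t$ uniformly without replacement; sample $\mathcal D_t\subseteq\{1,\dots,N\}$ of size $s_t$ uniformly without replacement; - let $\mu^t=\frac1{s_t}\sum_{j\in\mathcal D_t}g_j$, where $g_j\in\mathbb{R}^d$ has $k$-th coordinate $f_j'\big(\sum_{l\in\mathcal B_t}(x_j)_l\,\omega^t_l\big)(x_j)_k$ if $k\in\mathcal C_t$ and $0$ otherwise; - for each $q$, select a (random) bijection $\pi_q$ of $\{1,\dots,P\}$; - for all $p,q$ in parallel, with $k=\pi_q(p)$: set $\bar\omega^{(0)}_{q,k}=\omega^t_{q,k}$, and for $i=0,\dots,B-1$ pick $j\in\{1,\dots,n\}$ uniformly at random (freshly for each $p,q,i$) and set $$\bar\omega^{(i+1)}_{q,k}=\bar\omega^{(i)}_{q,k}-\gamma_{t+1}\Big[\nabla_{\omega_{q,k}}f_j^p(x_j^{p,q,k}\bar\omega^{(i)}_{q,k})-\nabla_{\omega_{q,k}}f_j^p(x_j^{p,q,k}\omega^t_{q,k})+\mu^t_{q,k}\Big],$$ where $\mu^t_{q,k}$ is the $(q,k)$ sub-block of $\mu^t$; - $\omega^{t+1}$ is the concatenation of all $\bar\omega^{(B)}_{q,k}$. All random choices are made independently of the past and of each other, except that $\mathcal C_t$ is drawn from $\mathcal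 B_t$. *)

(* Defs.v *)
From HB Require Import structures.
From mathcomp Require Import all_boot all_order all_algebra all_fingroup.
From mathcomp Require Import all_classical all_reals all_analysis.

Set Implicit Arguments.
Unset Strict Implicit.
Unset Printing Implicit Defensive.

Import Order.TTheory GRing.Theory Num.Theory.
Import numFieldNormedType.Exports.

Local Open Scope classical_set_scope.
Local Open Scope ring_scope.

(* The norm that the library puts on matrices is the sup norm, hence: *)
Definition enorm (R : realType) (d : nat) (v : 'cV[R]_d) : R :=
  Num.sqrt (\sum_(i < d) v i 0 ^+ 2).

Definition gradient (R : realType) (d : nat) (g : 'cV[R]_d -> R)
    (w : 'cV[R]_d) : 'cV[R]_d :=
  \col_(k < d) 'D_(delta_mx k 0) g w.

Definition strongly_convex (R : realType) (d : nat) (xi : R)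
    (g : 'cV[R]_d -> R) : Prop :=
  forall (v w : 'cV[R]_d) (a : R), 0 <= a <= 1 ->
    g (a *: v + (1 - a) *: w) <=
      a * g v + (1 - a) * g w - xi / 2%:R * a * (1 - a) * enorm (v - w) ^+ 2.

Definition unique_minimizer (U : Type) (R : realType) (g : U -> R) (u : U) :
    Prop :=
  (forall v, g u <= g v) /\ (forall u', (forall v, g u' <= g v) -> u' = u).

Definition linear_loss (R : realType) (d : nat) (f : R -> R) (x : 'rV[R]_d)
    (w : 'cV[R]_d) : R :=
  f ((x *m w) 0 0).

Definition objective (R : realType) (N d : nat) (f : 'I_N -> R -> R)
    (x : 'I_N -> 'rV[R]_d) (w : 'cV[R]_d) : R :=
  N%:R^-1 * \sum_(i < N) linear_loss (f i) (x i) w.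

(* The d features are laid out as
     (1,1), ..., (1,P), (2,1), ..., (Q,P),
   each sub-block (q,k) being an interval of m = d / (Q P) coordinates; with
   0-based indices, feature i of sub-block (q,k) is coordinate
   (q P + k) m + i. *)
Lemma feature_idx_subproof (d P Q : nat) (hd : (Q * P %| d)%N)
    (q : 'I_Q) (k : 'I_P) (i : 'I_(d %/ (Q * P))) :
  ((q * P + k) * (d %/ (Q * P)) + i < d)%N.
Proof.
rewrite -[ltnRHS](divnK hd) mulnC.
apply: (@leq_trans ((q * P + k).+1 * (d %/ (Q * P)))%N).
  by rewrite mulnC mulSn addnC ltn_add2r.
rewrite mulnC leq_mul2l; apply/orP; right.
apply: (@leq_trans (q.+1 * P)%N); first by rewrite mulSn addnC ltn_add2r.
by rewrite leq_mul2r ltn_ord orbT.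
Qed.

Definition feature_idx (d P Q : nat) (hd : (Q * P %| d)%N)
    (q : 'I_Q) (k : 'I_P) (i : 'I_(d %/ (Q * P))) : 'I_d :=
  Ordinal (feature_idx_subproof hd q k i).

Lemma feature_pos (d P Q : nat) (hd : (Q * P %| d)%N) (l : 'I_d) :
  [/\ (0 < P)%N, (0 < d %/ (Q * P))%N & (l %/ (d %/ (Q * P)) < Q * P)%N].
Proof.
have d0 : (0 < d)%N by exact: leq_ltn_trans (ltn_ord l).
have QP0 : (0 < Q * P)%N by exact: dvdn_gt0 hd.
have m0 : (0 < d %/ (Q * P))%N by rewrite divn_gt0// dvdn_leq.
split => //; first by move: QP0; rewrite muln_gt0 => /andP[].
by rewrite ltn_divLR// mulnC divnK.
Qed.

Lemma feature_block_subproof (d P Q : nat) (hd : (Q * P %| d)%N) (l : 'I_d) :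
  (l %/ (d %/ (Q * P)) %/ P < Q)%N.
Proof. by have [P0 _ h] := feature_pos hd l; rewrite ltn_divLR. Qed.

Lemma feature_subblock_subproof (d P Q : nat) (hd : (Q * P %| d)%N)
    (l : 'I_d) : (l %/ (d %/ (Q * P)) %% P < P)%N.
Proof. by have [P0 _ _] := feature_pos hd l; rewrite ltn_mod. Qed.

Lemma feature_offset_subproof (d P Q : nat) (hd : (Q * P %| d)%N)
    (l : 'I_d) : (l %% (d %/ (Q * P)) < d %/ (Q * P))%N.
Proof. by have [_ m0 _] := feature_pos hd l; rewrite ltn_mod. Qed.

Definition row_subblock (R : realType) (d P Q : nat) (hd : (Q * P %| d)%N)
    (x : 'rV[R]_d) (q : 'I_Q) (k : 'I_P) : 'rV[R]_(d %/ (Q * P)) :=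
  \row_i x 0 (feature_idx hd q k i).

Definition subblock (R : realType) (d P Q : nat) (hd : (Q * P %| d)%N)
    (w : 'cV[R]_d) (q : 'I_Q) (k : 'I_P) : 'cV[R]_(d %/ (Q * P)) :=
  \col_i w (feature_idx hd q k i) 0.

Definition concat_subblocks (R : realType) (d P Q : nat) (hd : (Q * P %| d)%N)
    (u : 'I_Q -> 'I_P -> 'cV[R]_(d %/ (Q * P))) : 'cV[R]_d :=
  \col_(l < d) u (Ordinal (feature_block_subproof hd l))
                 (Ordinal (feature_subblock_subproof hd l))
                 (Ordinal (feature_offset_subproof hd l)) 0.

Lemma concat_subblocksK (R : realType) (d P Q : nat) (hd : (Q * P %| d)%N)
    (u : 'I_Q -> 'I_P -> 'cV[R]_(d %/ (Q * P))) (q : 'I_Q) (k : 'I_P) :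
  subblock hd (concat_subblocks hd u) q k = u q k.
Proof.
apply/colP => i; rewrite !mxE.
have [P0 m0 _] := feature_pos hd (feature_idx hd q k i).
have E : (((q * P + k) * (d %/ (Q * P)) + i) %/ (d %/ (Q * P)) = q * P + k)%N.
  by rewrite divnMDl// divn_small// addn0.
congr (u _ _ _ _); apply/val_inj => /=.
- by rewrite E divnMDl// divn_small// addn0.
- by rewrite E modnMDl modn_small.
- by rewrite modnMDl modn_small.
Qed.

Lemma subblockK (R : realType) (d P Q : nat) (hd : (Q * P %| d)%N)
    (w : 'cV[R]_d) : concat_subblocks hd (subblock hd w) = w.
Proof.
apply/colP => l; rewrite !mxE; congr (w _ _); apply/val_inj => /=.
by rewrite -divn_eq -divn_eq.
Qed.

(* The random choices, as functions on a sample space T. In draw_pick, the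
   arguments are the iteration t, the observation partition p, the feature
   block q and the inner iteration i. *)
Record sodda_draws (T : Type) (N d P Q B : nat) := SoddaDraws {
  draw_B : nat -> T -> {set 'I_d};
  draw_C : nat -> T -> {set 'I_d};
  draw_D : nat -> T -> {set 'I_N};
  draw_perm : nat -> 'I_Q -> T -> {perm 'I_P};
  draw_pick : nat -> 'I_P -> 'I_Q -> 'I_B -> T -> 'I_(N %/ P)
}.

Definition masked_gradient (R : realType) (d : nat) (f : R -> R)
    (x : 'rV[R]_d) (w : 'cV[R]_d) (B C : {set 'I_d}) : 'cV[R]_d :=
  \col_(k < d) (if k \in C then derive1 f (\sum_(l in B) x 0 l * w l 0) * x 0 k
                else 0).

Definition gradient_estimate (R : realType) (N d : nat) (f : 'I_N -> R -> R)
    (x : 'I_N -> 'rV[R]_d) (s : nat) (w : 'cV[R]_d) (B C : {set 'I_d})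
    (D : {set 'I_N}) : 'cV[R]_d :=
  s%:R^-1 *: \sum_(j in D) masked_gradient (f j) (x j) w B C.

Definition local_step (R : realType) (N d P Q : nat) (hd : (Q * P %| d)%N)
    (f : 'I_N -> R -> R) (x : 'I_N -> 'rV[R]_d)
    (obs : 'I_P -> 'I_(N %/ P) -> 'I_N) (g : R) (w mu : 'cV[R]_d)
    (p : 'I_P) (q : 'I_Q) (k : 'I_P) (v : 'cV[R]_(d %/ (Q * P)))
    (j : 'I_(N %/ P)) : 'cV[R]_(d %/ (Q * P)) :=
  let h := linear_loss (f (obs p j)) (row_subblock hd (x (obs p j)) q k) in
  v - g *: (gradient h v - gradient h (subblock hd w q k)
            + subblock hd mu q k).

(* Sub-block (q,k) is updated by the unique p with pi_q(p) = k. *)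
Fixpoint sodda_iter (R : realType) (T : Type) (N d P Q B : nat)
    (hd : (Q * P %| d)%N) (f : 'I_N -> R -> R) (x : 'I_N -> 'rV[R]_d)
    (obs : 'I_P -> 'I_(N %/ P) -> 'I_N) (gamma : nat -> R) (s : nat -> nat)
    (S : sodda_draws T N d P Q B) (t : nat) (o : T) : 'cV[R]_d :=
  if t is t'.+1 then
    let w := sodda_iter hd f x obs gamma s S t' o in
    let mu := gradient_estimate f x (s t') w
                (draw_B S t' o) (draw_C S t' o) (draw_D S t' o) in
    concat_subblocks hd (fun q k =>
      let p := ((draw_perm S t' q o)^-1)%g k in
      foldl (local_step hd f x obs (gamma t'.+1) w mu p q k)
            (subblock hd w q k)
            [seq draw_pick S t' p q i o | i <- enum 'I_B])
  else 0.

(* Finite subfamilies are enumerated by injections from ordinals. *)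
Definition mutually_independent (disp : measure_display)
    (T : measurableType disp) (R : realType) (Pr : probability T R)
    (I : Type) (G : I -> set (set T)) : Prop :=
  forall (k : nat) (idx : 'I_k -> I) (E : 'I_k -> set T),
    injective idx -> (forall a, G (idx a) (E a)) ->
    Pr (\bigcap_(a in [set: 'I_k]) E a) = (\prod_(a < k) Pr (E a))%E.

(* Index set of the independent random choices; C_t is drawn from B_t, so that
   these two form a single choice. *)
Inductive draw_idx (P Q B : nat) : Type :=
| FeatureDraw of nat
| ObservationDraw of nat
| PermDraw of nat & 'I_Q
| PickDraw of nat & 'I_P & 'I_Q & 'I_B.

(* All the choices take finitely many values: the sigma-algebra they generate
   consists of the preimages of arbitrary sets of values. *)
Definition draw_events (T : Type) (N d P Q B : nat)
    (S : sodda_draws T N d P Q B) (c : draw_idx P Q B) : set (set T) :=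
  match c with
  | FeatureDraw t =>
      preimage_set_system setT (fun o => (draw_B S t o, draw_C S t o)) setT
  | ObservationDraw t => preimage_set_system setT (draw_D S t) setT
  | PermDraw t q => preimage_set_system setT (draw_perm S t q) setT
  | PickDraw t p q i => preimage_set_system setT (draw_pick S t p q i) setT
  end.

(* Probability that a uniformly random k-element subset of A is A'. *)
Definition uniform_subset (R : realType) (I : finType) (A : {set I}) (k : nat)
    (A' : {set I}) : R :=
  if (A' \subset A) && (#|A'| == k) then 'C(#|A|, k)%:R^-1 else 0.

(* The law of the bijections pi_q is left arbitrary. *)
Definition sodda_sampling (disp : measure_display) (T : measurableType disp)
    (R : realType) (Pr : probability T R) (N d P Q B : nat)
    (b c s : nat -> nat) (S : sodda_draws T N d P Q B) : Prop :=
  [/\ forall i E, draw_events S i E -> measurable E,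
      forall t A, Pr [set o | draw_B S t o = A] =
        (uniform_subset R [set: 'I_d]%SET (b t) A)%:E,
      forall t A A', Pr [set o | draw_B S t o = A /\ draw_C S t o = A'] =
        (Pr [set o | draw_B S t o = A] * (uniform_subset R A (c t) A')%:E)%E,
      forall t A, Pr [set o | draw_D S t o = A] =
        (uniform_subset R [set: 'I_N]%SET (s t) A)%:E
    & (forall t p q i j,
        Pr [set o | draw_pick S t p q i o = j] = ((N %/ P)%:R^-1)%:E)
      /\ mutually_independent Pr (draw_events S)].

(* Main.v *)
(* Conditionally on the past, E<mu, w - ws> = (c/d) <grad F(w), w - ws> up to the
   bias due to the features outside B_t, which is O(gamma^2); the inner loops
   move each sub-block by -B gamma mu up to O(gamma^2) because the iterates are
   bounded. With strong convexity, a_t = |w_t - ws|^2 thus satisfies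
     E[a_{t+1} | past] <= exp(-kappa gamma_{t+1}) a_t + K gamma_{t+1}^2.
   Hence a_t + K sum_{i > t} gamma_i^2 is a nonnegative supermartingale whose mean
   tends to 0, and Ville's maximal inequality gives almost sure convergence. As
   all draws take finitely many values, conditioning on the past is conditioning
   on one of finitely many cylinders. *)
Require Import Defs.
From HB Require Import structures.
From mathcomp Require Import all_boot all_order all_algebra all_fingroup.
From mathcomp Require Import all_classical all_reals all_analysis.
From mathcomp Require Import ring lra zify.

Set Implicit Arguments.
Unset Strict Implicit.
Unset Printing Implicit Defensive.

Import Order.TTheory GRing.Theory Num.Theory.
Import numFieldNormedType.Exports.

Local Open Scope classical_set_scope.
Local Open Scope ring_scope.

(** * Almost sure convergence of contracting finite-valued recursions *)

(** A local gradient sees a single sub-block and is not a block of the gradient of F, so averaging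
    over the inner loops would not help. These gradients enter only as differences at two points
    O(gamma) apart; with the step size in front this is O(gamma^2) for every outcome of the
    bijections and picks, and expectations are taken over (B_t, C_t, D_t) alone. The derivatives
    f_j' are evaluated at partial inner products, over B_t or over a sub-block, where (3) does not
    speak directly. Hence (3) is first turned into a Lipschitz bound on the scalar function f_j',
    weighted by |x_jk|, which applies to any partial inner product. All estimates are then
    coordinatewise, with crude constants that depend on the data but not on t. The contraction
    factor is an exponential because 1 - kappa gamma could be negative for the early learning rates.
    The iterates are bounded only almost surely, so boundedness is available exactly on the
    histories of positive probability. *)

Section potential.
Context {R : realType} (rho e tau : nat -> R).

(* Given that [V] has value [y] at time [n], [potential n k y] bounds [lam] times
   the probability that [V] reaches [lam] at some time from [n + k] on. *)
Fixpoint potential (n k : nat) (y : R) : R :=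
  if k is k'.+1 then potential n.+1 k' (rho n * y + e n) else y + tau n.

Fixpoint affine_rec (n k : nat) (y : R) : R :=
  if k is k'.+1 then affine_rec n.+1 k' (rho n * y + e n) else y.

Lemma potentialD j n k y :
  potential n (j + k) y = potential (n + j) k (affine_rec n j y).
Proof.
elim: j n y => [|j IH] n y; first by rewrite addn0.
by rewrite addSn /= IH addSnnS.
Qed.

Hypothesis rho01 : forall n, 0 <= rho n <= 1.
Hypothesis e_ge0 : forall n, 0 <= e n.
Hypothesis e_le_tau : forall n, e n + tau n.+1 <= tau n.

(** Only the initial value is contracted. The errors of the steps n, ..., n+k-1, left undamped since
    [rho] is at most 1, add up with [tau (n + k)] to at most [tau n]. *)
Lemma potential_le n k y : potential n k y <= \prod_(n <= i < n + k) rho i * y + tau n.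
Proof.
elim: k n y => [|k IH] n y /=; first by rewrite addn0 big_geq// mul1r.
apply: (le_trans (IH _ _)).
rewrite addSnnS [X in _ <= X * _ + _]big_ltn ?addnS ?ltnS ?leq_addr//.
set p := \prod_(_ <= _ < _) _.
have p1 : p <= 1.
  by rewrite /p Num.Theory.prodr_ile1.
have := e_le_tau n; have := e_ge0 n => e0 et.
have : p * e n <= e n by rewrite -[leRHS]mul1r ler_wpM2r.
nra.
Qed.

(** [potential n k] is affine with nonnegative slope, so it commutes with averages and preserves
    bounds on them. The weights have total mass p rather than 1, as they will be probabilities of
    cylinders. *)
Lemma potential_wsum (I : finType) (q z : I -> R) n k (p y : R) :
  (forall i, 0 <= q i) -> \sum_i q i = p -> \sum_i q i * z i <= p * y ->
  \sum_i q i * potential n k (z i) <= p * potential n k y.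
Proof.
move=> q0 qp; elim: k n z y => [|k IH] n z y /= qz.
  under eq_bigr do rewrite mulrDr.
  by rewrite big_split/= -mulr_suml qp mulrDr lerD2r.
apply: IH; under eq_bigr do rewrite mulrDr mulrCA.
rewrite big_split/= -mulr_suml -mulr_sumr qp mulrDr lerD2r mulrCA.
by rewrite ler_wpM2l//; case/andP: (rho01 n).
Qed.

Lemma potential_cvg0 y : 0 <= y ->
  (forall n, \prod_(n <= i < n + k) rho i @[k --> \oo] --> (0 : R)) ->
  tau @ \oo --> (0 : R) ->
  (forall n, 0 <= tau n) ->
  potential 0 k y @[k --> \oo] --> (0 : R).
Proof.
move=> y0 rho_cvg tau_cvg tau0.
have pot0 n k z : 0 <= z -> 0 <= potential n k z.
  elim: k n z => [|k IH] n z z0 /=; first by rewrite addr_ge0.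
  apply: IH; rewrite addr_ge0// mulr_ge0//; by case/andP: (rho01 n).
apply/cvgrPdist_lt => eps eps0.
have e20 : 0 < eps / 2 by lra.
move/cvgrPdist_lt : tau_cvg => /(_ _ e20) [n _ /(_ n (leqnn n)) /=].
rewrite sub0r normrN ger0_norm// => taun.
(* The errors made before time n are part of [u] and are contracted by the later factors; those made
   from n on cost at most [tau n], below eps / 2. *)
set u := affine_rec 0 n y.
have : \prod_(n <= i < n + k) rho i * u @[k --> \oo] --> (0 : R).
  by rewrite -[X in _ --> X](mul0r u); apply: cvgMl; apply: rho_cvg.
move/cvgrPdist_lt => /(_ _ e20) [m _ Hm].
exists (n + m)%N => // k /= nmk.
rewrite sub0r normrN ger0_norm ?pot0//.
rewrite -(@subnKC n k) ?(leq_trans _ nmk) ?leq_addr// potentialD add0n -/u.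
apply: le_lt_trans (potential_le _ _ _) _.
have /Hm /= : (m <= k - n)%N by rewrite leq_subRL// (leq_trans _ nmk)// leq_addr.
rewrite sub0r normrN => /(le_lt_trans (ler_norm _)); lra.
Qed.

End potential.

(** * Histories of finite-valued draws and the states they determine *)

Section cylinders.
Context {T : Type} {St : Type} {X : Type}.
Variables (Y : nat -> T -> St) (x0 : X) (Phi : nat -> X -> St -> X).

Fixpoint trajectory (n : nat) (o : T) : X :=
  if n is n'.+1 then Phi n' (trajectory n' o) (Y n' o) else x0.

(* Histories are listed most recent step first. *)
Fixpoint cylinder (h : seq St) : set T :=
  if h is st :: h' then cylinder h' `&` [set o | Y (size h') o = st] else setT.

Fixpoint state (h : seq St) : X :=
  if h is st :: h' then Phi (size h') (state h') st else x0.

Lemma trajectory_cylinder h o : cylinder h o -> trajectory (size h) o = state h.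
Proof. by elim: h => //= st h IH [/IH -> ->]. Qed.

End cylinders.

(** * Maximal inequality along histories *)

Section maximal.
Context {disp : measure_display} {T : measurableType disp} {R : realType}
  (Pr : probability T R) {St : finType}.
Variable Y : nat -> T -> St.
Hypothesis mY : forall n st, measurable [set o | Y n o = st].

Lemma cylinder_measurable h : measurable (cylinder Y h).
Proof. by elim: h => //= st h IH; exact: measurableI. Qed.

Lemma fine_prE (A : set T) : measurable A -> (fine (Pr A))%:E = Pr A.
Proof. by move=> mA; rewrite fineK// fin_num_measure. Qed.

Lemma fine_pr_ge0 (A : set T) : 0 <= fine (Pr A).
Proof. exact: fine_ge0. Qed.

Lemma fine_pr_le (A A' : set T) : measurable A -> measurable A' ->
  A `<=` A' -> fine (Pr A) <= fine (Pr A').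
Proof.
by move=> mA mA' AA'; rewrite fine_le ?fin_num_measure// le_measure ?inE.
Qed.

Lemma fine_pr_partition (J : finType) (Z : T -> J) (A : set T) :
  (forall j, measurable [set o | Z o = j]) -> measurable A ->
  fine (Pr A) = \sum_j fine (Pr (A `&` [set o | Z o = j])).
Proof.
move=> mZ mA; apply: EFin_inj; rewrite -sumEFin fine_prE//.
rewrite [RHS](eq_bigr (fun j => Pr (A `&` [set o | Z o = j]))); last first.
  by move=> j _; rewrite fine_prE//; exact: measurableI.
have AE : A = \bigcup_(j in [set: J]) (A `&` [set o | Z o = j]).
  by rewrite -setI_bigcupr predeqE => o; split=> [Ao|[]//]; split=> //;
    exists (Z o).
rewrite {1}AE measure_fin_bigcup//=; last 2 first.
- by move=> i j _ _ [z [[_ <-] [_ <-]]].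
- by move=> j _; exact: measurableI.
rewrite -[RHS]big_enum/= [RHS]fsbig_seq ?enum_uniq//; apply: eq_fsbigl.
by rewrite predeqE => j; split => //= _; rewrite mem_enum.
Qed.

Variables (X : Type) (x0 : X) (Phi : nat -> X -> St -> X).
Local Notation trajectory := (trajectory Y x0 Phi).
Local Notation state := (state x0 Phi).
Local Notation cylinder := (cylinder Y).

(** [X] carries no sigma-algebra: arbitrary sets [D] are allowed because finitely many draws from a
    finite type determine the state. The induction replaces [D] by its preimage under each one-step
    map. *)
Lemma trajectory_measurable (D : set X) n : measurable [set o | D (trajectory n o)].
Proof.
elim: n D => [|n IH] D /=.
  by have [D0|D0] := pselect (D x0); [rewrite (_ : mkset _ = setT)|
    rewrite (_ : mkset _ = set0)] => //; rewrite predeqE => o; split.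
rewrite (_ : mkset _ = \bigcup_(st in [set: St])
    ([set o | Y n o = st] `&` [set o | D (Phi n (trajectory n o) st)])).
  apply: fin_bigcup_measurable => // st _; apply: measurableI => //.
  exact: (IH [set z | D (Phi n z st)]).
rewrite predeqE => o; split => /= [Do|[st _ [<-]]//].
by exists (Y n o).
Qed.

Variables (V : X -> R) (rho e tau : nat -> R).
Hypothesis V_ge0 : forall z, 0 <= V z.
Hypothesis rho01 : forall n, 0 <= rho n <= 1.
Hypothesis tau_ge0 : forall n, 0 <= tau n.
Hypothesis e_le_tau : forall n, e n + tau n.+1 <= tau n.
(** The conditional inequality E[V' | h] <= rho V + e, multiplied by the probability of h: without
    division, a null history imposes nothing. *)
Hypothesis drift : forall h,
  \sum_st fine (Pr (cylinder (st :: h))) * V (state (st :: h)) <=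
  fine (Pr (cylinder h)) * (rho (size h) * V (state h) + e (size h)).

(** The time window is finite so that the maximal inequality can be proved by induction on its
    length; infinite windows come from continuity of the measure. *)
Definition exceed (lam : R) (n m : nat) : set T :=
  [set o | exists2 t, (n <= t <= n + m)%N & lam <= V (trajectory t o)].

Lemma exceed_measurable lam n m : measurable (exceed lam n m).
Proof.
rewrite (_ : exceed _ _ _ = \bigcup_(t in [set t | (n <= t <= n + m)%N])
    [set o | lam <= V (trajectory t o)]).
  by apply: bigcup_measurable => t _;
    exact: (trajectory_measurable [set z | lam <= V z]).
by rewrite predeqE => o; split => [[t nt lt]|[t nt lt]]; exists t.
Qed.

Lemma exceed_partition lam h n m :
  fine (Pr (cylinder h `&` exceed lam n m)) =
  \sum_st fine (Pr (cylinder (st :: h) `&` exceed lam n m)).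
Proof.
rewrite (fine_pr_partition (mY (size h))).
  by apply: eq_bigr => st _ /=; rewrite setIAC.
by apply: measurableI; [exact: cylinder_measurable|exact: exceed_measurable].
Qed.

Lemma sum_cylinder h :
  \sum_st fine (Pr (cylinder (st :: h))) = fine (Pr (cylinder h)).
Proof.
rewrite [RHS](fine_pr_partition (mY (size h)))//; exact: cylinder_measurable.
Qed.

(* Ville's maximal inequality, localized to a cylinder. *)
Lemma cylinder_exceed0 lam m h : 0 <= lam ->
  lam * fine (Pr (cylinder h `&` exceed lam (size h) m)) <=
  fine (Pr (cylinder h)) * (V (state h) + tau (size h)).
Proof.
move=> lam0.
have big h' n m' : lam <= V (state h') ->
    lam * fine (Pr (cylinder h' `&` exceed lam n m')) <=
    fine (Pr (cylinder h')) * (V (state h') + tau (size h')).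
  move=> lamV; have mh := cylinder_measurable h'.
  rewrite mulrC ler_pM ?fine_pr_ge0//.
    apply: fine_pr_le => //.
    by apply: measurableI => //; exact: exceed_measurable.
  by rewrite (le_trans lamV)// lerDl.
(* If V is already at least lam at h, Markov's bound suffices. Otherwise lam can only be reached
   later, and the bounds for the one-step extensions of h add up to the one for h because V + tau is
   a supermartingale. *)
elim: m h => [|m IH] h; have [lamV|Vlam] := leP lam (V (state h)); try exact: big.
  rewrite (_ : _ `&` _ = set0).
    by rewrite measure0 mulr0 mulr_ge0 ?fine_pr_ge0 ?addr_ge0.
  rewrite predeqE => o; split => //= -[ho [t]]; rewrite addn0 -eqn_leq => /eqP <-.
  by rewrite (trajectory_cylinder _ _ ho) leNgt Vlam.
rewrite exceed_partition mulr_sumr.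
apply: (@le_trans _ _ (\sum_st fine (Pr (cylinder (st :: h))) *
    (V (state (st :: h)) + tau (size h).+1))).
  apply: ler_sum => st _; apply: le_trans (IH (st :: h)).
  rewrite ler_wpM2l// fine_pr_le//.
  - apply: measurableI; [exact: (cylinder_measurable (st :: h))|].
    exact: exceed_measurable.
  - apply: measurableI; [exact: (cylinder_measurable (st :: h))|].
    exact: exceed_measurable.
  move=> o [ho [t /andP[ht th] lamt]]; split => //.
  exists t => //; rewrite /= addSnnS th andbT ltn_neqAle ht andbT.
  apply/eqP => htE; move: lamt; rewrite -htE.
  by rewrite (trajectory_cylinder _ _ ho.1) leNgt Vlam.
under eq_bigr do rewrite mulrDr.
rewrite big_split/= -mulr_suml sum_cylinder.
apply: (le_trans (lerD (drift h) (lexx _))).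
rewrite -mulrDr ler_wpM2l ?fine_pr_ge0// -addrA lerD//.
by rewrite ler_piMl//; case/andP: (rho01 (size h)).
Qed.

(** During the first k steps only the mean of V is tracked, by the affine recursion; the maximal
    inequality takes over at time [size h + k]. *)
Lemma cylinder_exceed lam k m h : 0 <= lam ->
  lam * fine (Pr (cylinder h `&` exceed lam (size h + k) m)) <=
  fine (Pr (cylinder h)) * potential rho e tau (size h) k (V (state h)).
Proof.
move=> lam0; elim: k h => [|k IH] h.
  by rewrite addn0; exact: cylinder_exceed0.
rewrite exceed_partition mulr_sumr -addSnnS /=.
apply: le_trans (@potential_wsum _ _ _ _ rho01 _
  (fun st => fine (Pr (cylinder (st :: h)))) (fun st => V (state (st :: h)))
  _ _ _ _ (fun=> fine_pr_ge0 _) (sum_cylinder h) (drift h)).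
by apply: ler_sum => st _; exact: (IH (st :: h)).
Qed.

Lemma exceed_le lam k m : 0 <= lam ->
  lam * fine (Pr (exceed lam k m)) <= potential rho e tau 0 k (V x0).
Proof.
move=> lam0; have := @cylinder_exceed lam k m [::] lam0.
by rewrite /= add0n setTI probability_setT mul1r.
Qed.

Hypothesis potential0 : potential rho e tau 0 k (V x0) @[k --> \oo] --> (0 : R).

(** To reach lam infinitely often is to reach it after every time k, which has probability at most
    the k-step potential divided by lam. *)
Lemma exceed_io_negligible lam : 0 < lam ->
  Pr.-negligible (\bigcap_k \bigcup_m exceed lam k m).
Proof.
move=> lam0.
have mk k : measurable (\bigcup_m exceed lam k m).
  by apply: bigcup_measurable => m _; exact: exceed_measurable.
have mI : measurable (\bigcap_k \bigcup_m exceed lam k m).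
  by apply: bigcap_measurable => //; exists 0%N.
apply/negligibleP => //.
have bnd k : fine (Pr (\bigcup_m exceed lam k m)) <=
    lam^-1 * potential rho e tau 0 k (V x0).
  rewrite -lee_fin fine_prE//.
  (* Continuity from below turns the bound, uniform in m, into one for the infinite window. *)
  have cv : Pr (exceed lam k m) @[m --> \oo] --> Pr (\bigcup_m exceed lam k m).
    apply: nondecreasing_cvg_mu => //; first by move=> m;
      exact: exceed_measurable.
    move=> m m' mm'; apply/subsetPset => o [t /andP[kt tk] lt]; exists t => //.
    by rewrite kt (leq_trans tk)// leq_add2l.
  rewrite -(cvg_lim _ cv)//; apply: lime_le; first by apply/cvg_ex; eexists;
    exact: cv.
  apply: nearW => m; rewrite -fine_prE ?lee_fin; last exact: exceed_measurable.
  by rewrite ler_pdivlMl// exceed_le// ltW.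
have cv0 : lam^-1 * potential rho e tau 0 k (V x0) @[k --> \oo] --> (0 : R).
  by rewrite -[X in _ --> X](mulr0 lam^-1); apply: cvgMr.
apply: etrans (esym (fine_prE mI)) _; congr (_%:E); apply/eqP;
  rewrite eq_le fine_pr_ge0 andbT.
rewrite -(cvg_lim _ cv0)//; apply: limr_ge; first by apply/cvg_ex; eexists;
  exact: cv0.
apply: nearW => k; apply: le_trans (bnd k); apply: fine_pr_le => //.
exact: bigcap_inf.
Qed.

(** The levels 1 / (j + 1) suffice, so failure of convergence is a countable union of negligible
    events. *)
Lemma trajectory_cvg0 : {ae Pr, forall o, V (trajectory t o) @[t --> \oo] --> (0 : R)}.
Proof.
apply: (@negligibleS _ _ _ _ (\bigcup_j \bigcap_k \bigcup_m exceed j.+1%:R^-1 k m)).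
  move=> o /= ncvg; apply: contrapT => nio; apply: ncvg.
  apply/cvgrPdist_lt => eps eps0.
  have [j _ /(_ j (leqnn j)) /= jeps] := near_infty_natSinv_lt (PosNum eps0).
  have [k nk] : exists k, ~ (\bigcup_m exceed j.+1%:R^-1 k m) o.
    by apply/not_existsP => h; apply: nio; exists j => // k _; apply: contrapT;
      exact: h.
  exists k => // t /= kt; rewrite sub0r normrN ger0_norm//.
  rewrite ltNge; apply/negP => epsV; apply: nk; exists (t - k)%N => //.
  exists t; first by rewrite kt subnKC//=.
  by apply: le_trans epsV; exact: ltW.
apply: negligible_bigcup => j; apply: exceed_io_negligible.
by rewrite invr_gt0 ltr0n.
Qed.

End maximal.

(** * Consequences of the two learning rate conditions *)

Lemma prod_expR_cvg0 (R : realType) (g : nat -> R) (kappa : R) (n : nat) :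
  0 < kappa -> (forall t, (1 <= t)%N -> 0 < g t) ->
  (\sum_(1 <= t <oo) (g t)%:E = +oo)%E ->
  \prod_(n <= i < n + k) expR (- (kappa * g i.+1)) @[k --> \oo] --> (0 : R).
Proof.
move=> kappa0 g0 goo.
have unb A : exists k0, A < \sum_(n <= i < n + k0) g i.+1.
  apply: contrapT => /forallNP hA.
  have : (\sum_(1 <= t <oo) (g t)%:E <= (\sum_(1 <= i < n.+1) g i + A)%:E)%E.
    apply: lime_le; first by apply: is_cvg_nneseries => t t1 _;
      rewrite lee_fin ltW// g0.
    exists n.+1 => // m /= nm; rewrite sumEFin lee_fin.
    rewrite (@big_cat_nat _ _ _ n.+1 1 m)//= lerD2l.
    have := hA (m - n.+1)%N; move/negP; rewrite -leNgt.
    by rewrite big_add1 (_ : (n + (m - n.+1))%N = m.-1)//; move: nm => /=; lia.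
  by rewrite goo leye_eq.
apply/cvgrPdist_lt => eps eps0.
(* With S the partial sum, exp(kappa S) >= 1 + kappa S > 1 / eps as soon as S > 1 / (eps kappa). *)
have [k0 Hk0] := unb (eps^-1 / kappa).
exists k0 => // k /= k0k.
rewrite sub0r normrN ger0_norm; last by rewrite prodr_ge0// => i _;
  exact: expR_ge0.
rewrite -expR_sum sumrN -mulr_sumr expRN.
rewrite -[ltRHS]invrK ltf_pV2 ?posrE ?expR_gt0 ?invr_gt0//.
have : eps^-1 / kappa < \sum_(n <= i < n + k) g i.+1.
  apply: lt_le_trans Hk0 _.
  rewrite (@big_cat_nat _ _ _ (n + k0) n (n + k))//= ?leq_addr ?leq_add2l// lerDl.
  by apply: sumr_ge0 => i _; rewrite ltW// g0.
rewrite ltr_pdivrMr// mulrC => /lt_le_trans; apply.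
by apply: le_trans (expR_ge1Dx _); rewrite lerDr.
Qed.

Lemma square_tail (R : realType) (g : nat -> R) (K : R) :
  0 <= K -> (\sum_(1 <= t <oo) ((g t) ^+ 2)%:E < +oo)%E ->
  exists tau : nat -> R, [/\ forall n, 0 <= tau n,
    forall n, K * g n.+1 ^+ 2 + tau n.+1 <= tau n & tau @ \oo --> (0 : R)].
Proof.
move=> K0 Sfin; set S := (X in (X < _)%E) in Sfin.
have S0 : (0 <= S)%E by apply: nneseries_ge0 => t _ _; rewrite lee_fin sqr_ge0.
have SE : S = (fine S)%:E by rewrite fineK// ge0_fin_numE.
(* This is K times the tail of the series over i > n, for which the required inequality is an
   equality. *)
exists (fun n => K * (fine S - \sum_(1 <= i < n.+1) g i ^+ 2)); split.
- move=> n; rewrite mulr_ge0// subr_ge0 -lee_fin -SE -sumEFin.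
  by apply: nneseries_lim_ge => t _ _; rewrite lee_fin sqr_ge0.
- move=> n; rewrite [in leLHS](@big_nat_recr _ _ _ n.+1)//=.
  by rewrite -mulrDr ler_wpM2l//; lra.
rewrite -[X in _ --> X](mulr0 K) -[X in K * X](subrr (fine S)).
apply: cvgMr; apply: cvgB; first exact: cvg_cst.
have cv : (\sum_(1 <= t < n) ((g t) ^+ 2)%:E)%E @[n --> \oo] --> S.
  by apply: is_cvg_nneseries => t _ _; rewrite lee_fin sqr_ge0.
have : (fun n => \sum_(1 <= t < n) g t ^+ 2) @ \oo --> fine S.
  move: cv; rewrite SE => /fine_cvgP[_]; apply: cvg_trans.
  by apply: near_eq_cvg; apply: nearW => n /=; rewrite sumEFin.
by rewrite -cvg_shiftS.
Qed.

(** * Gradients of linear losses *)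

Lemma enorm_ge0 (R : realType) d (v : 'cV[R]_d) : 0 <= enorm v.
Proof. exact: sqrtr_ge0. Qed.

Lemma sqr_enorm (R : realType) d (v : 'cV[R]_d) :
  enorm v ^+ 2 = \sum_i v i 0 ^+ 2.
Proof. by rewrite sqr_sqrtr// sumr_ge0// => i _; exact: sqr_ge0. Qed.

Lemma enormZ (R : realType) d (a : R) (v : 'cV[R]_d) :
  enorm (a *: v) = `|a| * enorm v.
Proof.
apply/eqP; rewrite -(eqrXn2 (n := 2))//; last 2 first.
- exact: enorm_ge0.
- by rewrite mulr_ge0// enorm_ge0.
rewrite exprMn !sqr_enorm real_normK ?num_real// mulr_sumr.
by apply/eqP; apply: eq_bigr => i _; rewrite mxE exprMn.
Qed.

Lemma normr_le_enorm (R : realType) d (v : 'cV[R]_d) (k : 'I_d) :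
  `|v k 0| <= enorm v.
Proof.
rewrite -(ler_pXn2r (n := 2)) ?nnegrE ?enorm_ge0// sqr_enorm.
rewrite real_normK ?num_real// (bigD1 k)//= lerDl.
by apply: sumr_ge0 => i _; exact: sqr_ge0.
Qed.

(** Going through the differential treats p = 0 together with the other directions; a change of
    variable h * p would not. *)
Lemma derive1_scale (R : realType) (f : R -> R) (y p : R) : derivable f y 1 ->
  h^-1 * (f (h * p + y) - f y) @[h --> 0^'] --> derive1 f y * p.
Proof.
move=> /derivable1_diffP df.
have := @diff_derivable _ _ _ f y p df; rewrite /derivable.
have -> : derive1 f y * p = 'D_p f y by rewrite deriveE// diff1E//= mulrC.
by [].
Qed.

Lemma gradient_linear_loss (R : realType) d (f : R -> R) (x : 'rV[R]_d)
    (w : 'cV[R]_d) : (forall y, derivable f y 1) ->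
  gradient (linear_loss f x) w = \col_k (derive1 f ((x *m w) 0 0) * x 0 k).
Proof.
move=> df; apply/colP => k; rewrite [LHS]mxE [RHS]mxE; apply: cvg_lim => //.
rewrite [X in X @ _ --> _](_ : _ = fun h : R =>
    h^-1 * (f (h * x 0 k + (x *m w) 0 0) - f ((x *m w) 0 0))).
  exact: (derive1_scale (df _)).
apply/funext => h; rewrite /= /linear_loss mulmxDr -scalemxAr -colE.
by congr (_ * (f _ - _)); rewrite mxE; congr (_ + _); rewrite !mxE.
Qed.

Section lipschitz.
Context {R : realType} {d : nat}.
Variables (f : R -> R) (x : 'rV[R]_d) (L : R).
Hypothesis df : forall y, derivable f y 1.
Hypothesis fL : forall w w', enorm (gradient (linear_loss f x) w -
  gradient (linear_loss f x) w') <= L * enorm (w - w').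

(* Testing the hypothesis on multiples of [x] itself turns it into a bound on
   the scalar derivative. *)
Lemma derive1_lipschitz (k : 'I_d) (u v : R) :
  `|derive1 f u - derive1 f v| * `|x 0 k| <=
  L / enorm x^T ^+ 2 * `|x 0 k| * `|u - v|.
Proof.
(* The factor |x_k| on both sides makes the claim trivial here, in particular for x = 0, where the
   gradients give no information on f'. *)
have [xk0|xk0] := eqVneq (x 0 k) 0; first by rewrite xk0 normr0 !mulr0 mul0r.
set n2 := enorm x^T ^+ 2.
have n20 : 0 < enorm x^T.
  apply: lt_le_trans (normr_le_enorm x^T k); by rewrite mxE normr_gt0.
have n0 : n2 != 0 by rewrite lt0r_neq0// exprn_gt0.
have xE a : (x *m ((a / n2) *: x^T)) 0 0 = a.
  rewrite -scalemxAr mxE [X in _ * X]mxE.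
  rewrite (eq_bigr (fun l => x^T l 0 ^+ 2)); last by move=> l _;
    rewrite mxE expr2.
  by rewrite -sqr_enorm mulfVK.
have := fL ((u / n2) *: x^T) ((v / n2) *: x^T).
rewrite !gradient_linear_loss// !xE -scalerBl enormZ.
rewrite [X in enorm X](_ : _ = (derive1 f u - derive1 f v) *: x^T); last first.
  by apply/colP => i; rewrite !mxE mulrBl.
rewrite enormZ mulrA ler_pM2r// => h.
rewrite mulrAC ler_wpM2r//; apply: (le_trans h).
by rewrite -mulrBl normrM [`|n2^-1|]ger0_norm ?invr_ge0 ?exprn_ge0 ?enorm_ge0// mulrA mulrAC.
Qed.

End lipschitz.

Section convexity.
Context {R : realType} {N d : nat}.
Variables (f : 'I_N -> R -> R) (x : 'I_N -> 'rV[R]_d) (xi : R).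
Hypothesis df : forall i y, derivable (f i) y 1.
Hypothesis xi0 : 0 < xi.
Hypothesis sc : strongly_convex xi (objective f x).

(** The difference quotient of F at w towards ws is at most -(xi / 2) (1 - h) |w - ws|^2, since ws
    minimizes F. Taking h < 1/2 gives the constant xi / 4 already before the limit, so that only the
    quotient itself has to converge. *)
Lemma strongly_convex_gradient (w ws : 'cV[R]_d) :
  (forall v, objective f x ws <= objective f x v) ->
  xi / 4%:R * enorm (w - ws) ^+ 2 <=
  \sum_k N%:R^-1 * (\sum_j derive1 (f j) ((x j *m w) 0 0) * x j 0 k) *
    (w k 0 - ws k 0).
Proof.
move=> wsmin.
pose q (h : R) := h^-1 * (objective f x (h *: (ws - w) + w) - objective f x w).
set s := \sum_k _.
have qs : q h @[h --> 0^'] --> - s.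
  have -> : - s = N%:R^-1 * \sum_j derive1 (f j) ((x j *m w) 0 0) *
      (x j *m (ws - w)) 0 0.
    rewrite /s -sumrN mulr_sumr.
    under eq_bigr do rewrite -mulrA -mulrN mulr_suml -sumrN mulr_sumr.
    rewrite exchange_big; apply: eq_bigr => j _ /=.
    rewrite [X in _ = _ * (_ * X)]mxE !mulr_sumr; apply: eq_bigr => k _.
    by rewrite [(ws - w) _ _]mxE [(- w) _ _]mxE; ring.
  have -> : q = fun h => N%:R^-1 * \sum_j h^-1 *
      (f j (h * (x j *m (ws - w)) 0 0 + (x j *m w) 0 0) - f j ((x j *m w) 0 0)).
    apply/funext => h; rewrite /q /objective -mulrBr -sumrB.
    rewrite mulrCA; congr (_ * _); rewrite mulr_sumr; apply: eq_bigr => j _;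
      congr (_ * (f j _ - _)).
    by rewrite mulmxDr -scalemxAr mxE [in X in X + _]mxE.
  apply: cvgMr; apply: cvg_big => //.
    exact: add_continuous.
  by move=> j _; apply: (@derive1_scale _ (f j) _ _ _); exact: df.
have {}qs := cvg_dnbhs_at_right qs.
rewrite -lerN2 -(cvg_lim _ qs)//.
apply: limr_le; first by apply/cvg_ex; eexists; exact: qs.
near=> h.
have h0 : 0 < h by near: h; exact: nbhs_right_gt.
have h2 : h < 1 / 2 by near: h; apply: nbhs_right_lt; lra.
rewrite /q ler_pdivrMl//.
have /(sc ws w) : 0 <= h <= 1 by lra.
rewrite -(_ : h *: (ws - w) + w = h *: ws + (1 - h) *: w); last first.
  by rewrite scalerBr scalerBl scale1r addrAC -addrA.
have -> : enorm (ws - w) ^+ 2 = enorm (w - ws) ^+ 2.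
  by rewrite !sqr_enorm; apply: eq_bigr => i _; rewrite !mxE; ring.
have := wsmin w; have := sqr_ge0 (enorm (w - ws)).
set E := enorm _ ^+ 2; move=> E0 Fle; clearbody E.
have : xi * h * E * (1 - 2 * h) >= 0.
  by rewrite !mulr_ge0 ?(ltW xi0) ?(ltW h0)//; lra.
have : 0 <= h * (objective f x w - objective f x ws).
  by rewrite mulr_ge0 ?(ltW h0)// subr_ge0.
lra.
Unshelve. all: by end_near.
Qed.

End convexity.

(** * Uniform subsets and the mean of the gradient estimate *)

Section uniform.
Context {R : realType} {I : finType}.
Implicit Types (A : {set I}) (k : nat) (i : I).

Lemma uniform_subset_ge0 A k A' : 0 <= uniform_subset R A k A'.
Proof. by rewrite /uniform_subset; case: ifP => // _; rewrite invr_ge0. Qed.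

Lemma sum_uniform_subset A k : (k <= #|A|)%N ->
  \sum_A' uniform_subset R A k A' = 1.
Proof.
move=> kA; rewrite /uniform_subset -big_mkcond/= sumr_const.
rewrite (eq_card (B := mem [set A' : {set I} | A' \subset A & #|A'| == k]));
  last first.
  by move=> A'; rewrite [RHS]inE.
by rewrite cards_draws -[LHS]mulr_natr mulVf// pnatr_eq0 -lt0n bin_gt0.
Qed.

(** Pascal's rule: the k-subsets of A that avoid i are the k-subsets of A minus i. *)
Lemma card_draws_mem A k i : i \in A -> (0 < k)%N ->
  #|[set A' : {set I} | (A' \subset A) && (#|A'| == k) & i \in A']| =
  'C(#|A|.-1, k.-1).
Proof.
move=> iA k0; set S := [set A' : {set I} | A' \subset A & #|A'| == k].
have := cardsID [set A' : {set I} | i \in A'] S.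
rewrite (_ : S :\: _ = [set A' : {set I} | A' \subset A :\ i & #|A'| == k]);
  last first.
  by apply/setP => A'; rewrite !inE subsetD1; case: (i \in A');
    rewrite ?andbF ?andbT.
rewrite !cards_draws -[in 'C(#|A|, k)](prednK k0).
have /prednK <- : (0 < #|A|)%N by apply/card_gt0P; exists i.
rewrite binS (cardsD1 i A) iA add1n /= (prednK k0) => /eqP.
rewrite addnC eqn_add2l => /eqP <-.
by apply: eq_card => A'; rewrite !inE.
Qed.

Lemma sum_uniform_subset_mem A k i : (0 < k <= #|A|)%N -> i \in A ->
  \sum_A' uniform_subset R A k A' * (i \in A')%:R = k%:R / #|A|%:R.
Proof.
move=> /andP[k0 kA] iA.
have A0 : (0 < #|A|)%N by exact: leq_trans kA.
transitivity (\sum_(A' in [set A' : {set I} | (A' \subset A) && (#|A'| == k) & i \in A'])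
   ('C(#|A|, k)%:R^-1 : R)).
  rewrite [RHS]big_mkcond/=; apply: eq_bigr => A' _; rewrite inE /uniform_subset.
  by case: ifP => /= _; case: (i \in A') => //=; rewrite ?mulr1 ?mulr0.
rewrite sumr_const card_draws_mem// -[LHS]mulr_natl.
have C0 : 'C(#|A|, k)%:R != 0 :> R by rewrite pnatr_eq0 -lt0n bin_gt0.
have A0' : #|A|%:R != 0 :> R by rewrite pnatr_eq0 -lt0n.
apply/eqP; rewrite eqr_div// -!natrM mulnC mul_bin_diag (prednK k0)//.
Qed.

Lemma sum_uniform_subset_mean k (y : I -> R) : (0 < k <= #|I|)%N ->
  \sum_A uniform_subset R [set: I]%SET k A * (k%:R^-1 * \sum_(i in A) y i) =
  #|I|%:R^-1 * \sum_i y i.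
Proof.
move=> kI; have /andP[k0 _] := kI.
transitivity (\sum_A \sum_i (k%:R^-1 * y i) *
    (uniform_subset R [set: I]%SET k A * (i \in A)%:R)).
  apply: eq_bigr => A _; rewrite !mulr_sumr big_mkcond/=; apply: eq_bigr => i _.
  by case: (i \in A) => /=; rewrite ?mulr1 ?mulr0// mulrC.
rewrite exchange_big mulr_sumr; apply: eq_bigr => i _ /=.
rewrite -mulr_sumr sum_uniform_subset_mem ?inE ?cardsT//.
have k0' : k%:R != 0 :> R by rewrite pnatr_eq0 -lt0n.
by rewrite mulrACA mulVf// mul1r mulrC.
Qed.

End uniform.

Section mean.
Context {R : realType} {N d : nat}.
Variables (f : 'I_N -> R -> R) (x : 'I_N -> 'rV[R]_d) (Lam X W : R).
Hypothesis Lam0 : 0 <= Lam.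
Hypothesis X0 : 0 <= X.
Hypothesis fLip : forall j k u v,
  `|derive1 (f j) u - derive1 (f j) v| * `|x j 0 k| <= Lam * `|u - v|.
Hypothesis xX : forall j k, `|x j 0 k| <= X.
Variables (b c s : nat).
Hypothesis cb : (1 <= c <= b)%N.
Hypothesis bd : (b <= d)%N.
Hypothesis sN : (1 <= s <= N)%N.

(** Joint law of (B_t, C_t, D_t). *)
Definition draw_weight (v : {set 'I_d} * {set 'I_d} * {set 'I_N}) : R :=
  uniform_subset R [set: 'I_d]%SET b v.1.1 *
  uniform_subset R v.1.1 c v.1.2 *
  uniform_subset R [set: 'I_N]%SET s v.2.

(** Coordinate k of the gradient of F when B is the full set; otherwise the inner products are
    truncated to B. *)
Definition mean_gradient (w : 'cV[R]_d) (B : {set 'I_d}) (k : 'I_d) : R :=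
  N%:R^-1 * \sum_j derive1 (f j) (\sum_(l in B) x j 0 l * w l 0) * x j 0 k.

Lemma mean_gradient_le (w : 'cV[R]_d) (B : {set 'I_d}) (k : 'I_d) :
  (forall l, `|w l 0| <= W) ->
  `|mean_gradient w B k - mean_gradient w [set: 'I_d]%SET k| <=
  Lam * X * W * #|~: B|%:R.
Proof.
move=> wW; have N0 : N%:R != 0 :> R by rewrite pnatr_eq0; lia.
rewrite -mulrBr -sumrB normrM ger0_norm ?invr_ge0//.
rewrite ler_pdivrMl ?ltr0n; last lia.
apply: (le_trans (ler_norm_sum _ _ _)).
rewrite mulr_natl -[in leRHS](card_ord N) -sumr_const; apply: ler_sum => j _.
rewrite -mulrBl normrM; apply: (le_trans (fLip _ _ _ _)).
rewrite -mulrA -mulrA ler_wpM2l//.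
have -> : \sum_(l in [set: 'I_d]%SET) x j 0 l * w l 0 =
    \sum_(l in B) x j 0 l * w l 0 + \sum_(l in ~: B) x j 0 l * w l 0.
  rewrite (bigID (mem B))/=; congr (_ + _); apply: eq_bigl => l; rewrite !inE//.
rewrite opprD addrA subrr sub0r normrN; apply: (le_trans (ler_norm_sum _ _ _)).
rewrite mulrA mulr_natr -sumr_const; apply: ler_sum => l _.
by rewrite normrM ler_pM.
Qed.

(** Averaging over D removes the subsampling of observations, and averaging over C given B gives c /
    b for k in B. The average over B stays, because B also sits inside the argument of f_j'. *)
Lemma mean_estimate (w : 'cV[R]_d) (k : 'I_d) : 
  \sum_v draw_weight v * gradient_estimate f x s w v.1.1 v.1.2 v.2 k 0 =
  \sum_B uniform_subset R [set: 'I_d]%SET b B *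
    (c%:R / b%:R * (k \in B)%:R * mean_gradient w B k).
Proof.
rewrite -(pair_big_dep xpredT (fun _ => xpredT) (fun p D =>
  draw_weight (p, D) * gradient_estimate f x s w p.1 p.2 D k 0))/=.
rewrite -(pair_big_dep xpredT (fun _ => xpredT) (fun B C => \sum_D
  draw_weight (B, C, D) * gradient_estimate f x s w B C D k 0))/=.
apply: eq_bigr => B _.
transitivity (\sum_C uniform_subset R [set: 'I_d]%SET b B *
    (uniform_subset R B c C * (k \in C)%:R * mean_gradient w B k)).
  apply: eq_bigr => C _.
  transitivity (uniform_subset R [set: 'I_d]%SET b B * uniform_subset R B c C *
     (k \in C)%:R * \sum_D (uniform_subset R [set: 'I_N]%SET s D *
       (s%:R^-1 * \sum_(j in D) derive1 (f j) (\sum_(l in B) x j 0 l * w l 0) * x j 0 k))).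
    rewrite mulr_sumr; apply: eq_bigr => D _.
    rewrite /draw_weight/= /gradient_estimate mxE summxE.
    case kC : (k \in C) => /=.
      rewrite mulr1 -mulrA; congr (_ * (_ * (_ * _))).
      by apply: eq_bigr => j _; rewrite mxE kC.
    rewrite mulr0 mul0r big1 ?mulr0// => j _; by rewrite mxE kC.
  rewrite sum_uniform_subset_mean ?card_ord// -!mulrA; congr (_ * (_ * _)).
rewrite -mulr_sumr -mulr_suml.
(* Only sets of size b carry weight, which makes c / b the inclusion probability. *)
have [Bb|Bb] := eqVneq #|B| b; last first.
  by rewrite /uniform_subset finset.subsetT/= (negbTE Bb) !mul0r.
congr (_ * (_ * _)).
case kB : (k \in B).
  by rewrite sum_uniform_subset_mem ?Bb ?mulr1//; lia.
rewrite mulr0 big1// => C _; rewrite /uniform_subset.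
case: ifP => [/andP[CB _]|]; last by rewrite mul0r.
case kC : (k \in C); last by rewrite mulr0.
by rewrite (fintype.subsetP CB k kC) in kB.
Qed.

(** With full inner products the mean factor would be exactly (c / b) (b / d) = c / d. Truncation is
    paid for separately for each B, all of which omit d - b features. *)
Lemma mean_estimate_le (w : 'cV[R]_d) (k : 'I_d) :
  (forall l, `|w l 0| <= W) ->
  `|\sum_v draw_weight v * gradient_estimate f x s w v.1.1 v.1.2 v.2 k 0 -
    c%:R / d%:R * mean_gradient w [set: 'I_d]%SET k| <=
  Lam * X * W * (d - b)%N%:R.
Proof.
move=> wW; rewrite mean_estimate.
have b0 : b%:R != 0 :> R by rewrite pnatr_eq0; lia.
have W0 : 0 <= W by apply: le_trans (wW k).
have -> : c%:R / d%:R * mean_gradient w [set: 'I_d]%SET k =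
   \sum_B uniform_subset R [set: 'I_d]%SET b B *
    (c%:R / b%:R * (k \in B)%:R * mean_gradient w [set: 'I_d]%SET k).
  transitivity (c%:R / b%:R * (\sum_B uniform_subset R [set: 'I_d]%SET b B * (k \in B)%:R)
     * mean_gradient w [set: 'I_d]%SET k).
    rewrite sum_uniform_subset_mem ?inE ?cardsT ?card_ord; [|lia|by []].
    by congr (_ * _); rewrite mulrA mulfVK.
  rewrite mulr_sumr mulr_suml; apply: eq_bigr => B _; ring.
rewrite -sumrB; apply: (le_trans (ler_norm_sum _ _ _)).
have -> : Lam * X * W * (d - b)%N%:R = \sum_B uniform_subset R [set: 'I_d]%SET b B *
    (Lam * X * W * (d - b)%N%:R).
  by rewrite -mulr_suml sum_uniform_subset ?mul1r// cardsT card_ord.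
apply: ler_sum => B _.
rewrite -mulrBr normrM (ger0_norm (uniform_subset_ge0 _ _ _)).
have [Bb|Bb] := eqVneq #|B| b; last first.
  by rewrite /uniform_subset finset.subsetT/= (negbTE Bb) !mul0r.
rewrite ler_wpM2l ?uniform_subset_ge0// -mulrBr normrM.
rewrite -[leRHS]mul1r ler_pM//.
  rewrite normrM ger0_norm ?divr_ge0// mulr_ile1 ?divr_ge0//.
    by rewrite ler_pdivrMr ?ltr0n ?mul1r ?ler_nat; lia.
  by case: (k \in B); rewrite ?normr1 ?normr0.
have := mean_gradient_le B k wW.
by rewrite cardsCs finset.setCK card_ord Bb.
Qed.

End mean.

(** * One step of the algorithm *)

Section update.
Context {R : realType} {N d P Q B : nat}.
Variables (hd : (Q * P %| d)%N) (f : 'I_N -> R -> R) (x : 'I_N -> 'rV[R]_d)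
  (obs : 'I_P -> 'I_(N %/ P) -> 'I_N) (gamma : nat -> R) (s : nat -> nat).
Variables (Lam X W C Gam : R).
Hypothesis df : forall i y, derivable (f i) y 1.
Hypothesis Lam0 : 0 <= Lam.
Hypothesis X0 : 0 <= X.
Hypothesis W0 : 0 <= W.
Hypothesis C0 : 0 <= C.
Hypothesis fLip : forall j k u v,
  `|derive1 (f j) u - derive1 (f j) v| * `|x j 0 k| <= Lam * `|u - v|.
Hypothesis xX : forall j k, `|x j 0 k| <= X.

Local Notation m := (d %/ (Q * P))%N.

(** Discrete Gronwall bound on the displacement after n local steps, in units of the learning rate;
    [Lam * X * m%:R] is the Lipschitz constant of a local gradient for the sup norm. *)
Fixpoint inner_dev (n : nat) : R :=
  if n is n'.+1 then (1 + Gam * (Lam * X * m%:R)) * inner_dev n' + C else 0.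

(** Departure of a local loop from the straight displacement -g n mu, in units of g^2. *)
Fixpoint inner_err (n : nat) : R :=
  if n is n'.+1 then inner_err n' + Lam * X * m%:R * inner_dev n' else 0.

Lemma inner_dev_ge0 n : 0 <= Gam -> 0 <= inner_dev n.
Proof.
by move=> G0; elim: n => //= n IH;
  rewrite addr_ge0// mulr_ge0// addr_ge0// !mulr_ge0.
Qed.

Lemma inner_err_ge0 n : 0 <= Gam -> 0 <= inner_err n.
Proof.
move=> G0; elim: n => //= n IH.
by rewrite addr_ge0// mulr_ge0// ?inner_dev_ge0// !mulr_ge0.
Qed.

Section inner.
Variables (g : R) (w mu : 'cV[R]_d) (p : 'I_P) (q : 'I_Q) (k : 'I_P).
Hypothesis g0 : 0 <= g.
Hypothesis gG : g <= Gam.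
Hypothesis muC : forall l, `|mu l 0| <= C.

Lemma local_gradient_le j (u v : 'cV[R]_m) (D : R) i :
  (forall i, `|u i 0 - v i 0| <= D) ->
  let h := linear_loss (f j) (row_subblock hd (x j) q k) in
  `|gradient h u i 0 - gradient h v i 0| <= Lam * X * m%:R * D.
Proof.
move=> uvD; rewrite /= !gradient_linear_loss// ![(\col__ _) _ _]mxE -mulrBl normrM.
rewrite [X in _ * `|X|]mxE; apply: (le_trans (fLip _ _ _ _)).
rewrite -!mulrA ler_wpM2l// !mxE -sumrB; apply: (le_trans (ler_norm_sum _ _ _)).
rewrite mulrCA mulr_natl -[in leRHS](card_ord m) -sumr_const;
  apply: ler_sum => l _.
by rewrite -mulrBr normrM mxE ler_pM.
Qed.

(** The correction added to mu is a gradient difference over a displacement of order g, hence of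
    order g; the step size turns it into g^2. *)
Lemma inner_loop_le (js : seq 'I_(N %/ P)) i :
  let v := foldl (local_step hd f x obs g w mu p q k) (subblock hd w q k) js in
  `|v i 0 - subblock hd w q k i 0| <= g * inner_dev (size js) /\
  `|v i 0 - subblock hd w q k i 0 + g * (size js)%:R * subblock hd mu q k i 0| <=
    g ^+ 2 * inner_err (size js).
Proof.
elim/last_ind: js i => [|js j IH] i /=.
  by rewrite subrr mulr0 mul0r addr0 normr0 !mulr0 lexx.
rewrite foldl_rcons size_rcons.
move: IH; set v := foldl _ _ _; set v0 := subblock _ _ _ _;
  set n := size js => IH.
have [IH1 IH2] := IH i.
rewrite {1 2}/local_step.
set dg := gradient _ v - gradient _ v0.
have dgE : `|dg i 0| <= Lam * X * m%:R * (g * inner_dev n).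
  rewrite /dg [X in `|X|]mxE [X in `|_ + X|]mxE.
  by apply: local_gradient_le => l; exact: (IH l).1.
have dev0 : 0 <= inner_dev n by apply: inner_dev_ge0; exact: le_trans gG.
have muE : `|subblock hd mu q k i 0| <= C by rewrite mxE.
have stepE (y z t : 'cV[R]_m) : (y - g *: (z + t)) i 0 = y i 0 - g * (z i 0 + t i 0).
  by rewrite !mxE.
rewrite !stepE.
set a := v i 0 in IH1 IH2 *; set b := v0 i 0 in IH1 IH2 *.
set e := dg i 0 in dgE *; set u := subblock hd mu q k i 0 in IH2 muE *.
set K := Lam * X * m%:R in dgE *.
have K0 : 0 <= K by rewrite !mulr_ge0.
have ge : `|g * e| <= g * (K * (g * inner_dev n)) by rewrite normrM ger0_norm// ler_wpM2l.
split.
  have -> : a - g * (e + u) - b = (a - b) - g * e - g * u by ring.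
  have gu : `|g * u| <= g * C by rewrite normrM ger0_norm// ler_wpM2l.
  apply: (le_trans (ler_normB _ _));
    apply: (le_trans (lerD (ler_normB _ _) (lexx _))).
  apply: (le_trans (lerD (lerD IH1 ge) gu)) => /=.
  (* One factor g is traded for [Gam], to keep the displacement bound linear in g with a constant
     independent of t. *)
  have : g * (K * (g * inner_dev n)) <= g * (K * (Gam * inner_dev n)).
    by rewrite !ler_wpM2l// ler_wpM2r.
  rewrite -/K; lra.
have -> : a - g * (e + u) - b + g * n.+1%:R * u = (a - b + g * n%:R * u) - g * e.
  by rewrite -natr1; ring.
apply: (le_trans (ler_normB _ _)); apply: (le_trans (lerD IH2 ge)) => /=.
rewrite -/K; lra.
Qed.

End inner.

(** All choices of one iteration, grouped so that the component (B, C, D), the only one averaged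
    over, can be separated from the bijections and picks. *)
Definition sodda_draw : finType :=
  (({set 'I_d} * {set 'I_d} * {set 'I_N}) *
   ({ffun 'I_Q -> {perm 'I_P}} * {ffun 'I_P * 'I_Q * 'I_B -> 'I_(N %/ P)}))%type.

Definition sodda_update (t : nat) (w : 'cV[R]_d) (st : sodda_draw) : 'cV[R]_d :=
  let mu := gradient_estimate f x (s t) w st.1.1.1 st.1.1.2 st.1.2 in
  concat_subblocks hd (fun q k =>
    let p := ((st.2.1 q)^-1)%g k in
    foldl (local_step hd f x obs (gamma t.+1) w mu p q k)
          (subblock hd w q k)
          [seq st.2.2 (p, q, i) | i <- enum 'I_B]).

Lemma gradient_estimate_le (F0 : R) (t : nat) (w : 'cV[R]_d)
    (Bs Cs : {set 'I_d}) (Ds : {set 'I_N}) (k : 'I_d) :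
  (1 <= t)%N -> (forall l, `|w l 0| <= W) -> 0 <= F0 ->
  (forall j k, `|derive1 (f j) 0 * x j 0 k| <= F0) ->
  `|gradient_estimate f x t w Bs Cs Ds k 0| <= N%:R * (F0 + Lam * X * W * d%:R).
Proof.
move=> t1 wW F00 fF; set K := F0 + _.
have K0 : 0 <= K by rewrite addr_ge0 ?mulr_ge0.
rewrite mxE summxE normrM ger0_norm ?invr_ge0// -[leRHS]mul1r ler_pM ?invr_ge0//.
  by rewrite invf_le1 ?ltr0n// ler1n.
apply: (le_trans (ler_norm_sum _ _ _)).
rewrite mulr_natl -[in leRHS](card_ord N) -sumr_const big_mkcond/=;
  apply: ler_sum => j _.
case: ifP => // _; rewrite mxE; case: ifP => _; last by rewrite normr0.
set u := \sum_(l in Bs) _.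
(* The Lipschitz bound controls f_j' only relative to a reference value, here at 0. *)
have -> : derive1 (f j) u * x j 0 k =
    derive1 (f j) 0 * x j 0 k + (derive1 (f j) u - derive1 (f j) 0) * x j 0 k by ring.
apply: (le_trans (ler_normD _ _)); rewrite lerD// normrM.
apply: (le_trans (fLip _ _ _ _)); rewrite subr0 -!mulrA ler_wpM2l//.
apply: (le_trans (ler_norm_sum _ _ _)).
rewrite mulrA mulr_natr -[in leRHS](card_ord d) -sumr_const big_mkcond/=;
  apply: ler_sum => l _.
by case: ifP => _; rewrite ?mulr_ge0// normrM ler_pM.
Qed.

(** A pathwise bound: it holds whichever partition serves a sub-block and whichever observations are
    picked. *)
Lemma sodda_update_le (t : nat) (w : 'cV[R]_d) (st : sodda_draw) (l : 'I_d) :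
  0 <= gamma t.+1 -> gamma t.+1 <= Gam ->
  let mu := gradient_estimate f x (s t) w st.1.1.1 st.1.1.2 st.1.2 in
  (forall l, `|mu l 0| <= C) ->
  `|sodda_update t w st l 0 - w l 0 + gamma t.+1 * B%:R * mu l 0| <=
    gamma t.+1 ^+ 2 * inner_err B.
Proof.
move=> g0 gG mu muC; rewrite mxE -/mu.
set q := Ordinal _; set k := Ordinal _; set i := Ordinal _.
have lE : feature_idx hd q k i = l.
  by apply/val_inj => /=; rewrite -divn_eq -divn_eq.
have := (@inner_loop_le (gamma t.+1) w mu (((st.2.1 q)^-1)%g k) q k g0 gG muC
  [seq st.2.2 (((st.2.1 q)^-1)%g k, q, i) | i <- enum 'I_B] i).2.
by rewrite size_map size_enum_ord [subblock hd w q k i 0]mxE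
  [subblock hd mu q k i 0]mxE lE.
Qed.

(** For one coordinate with y = w - ws, |y| <= Y, and update -g B u + r: the first term bounds 2 y r
    / g^2, the second (r - g B u)^2 / g^2. *)
Definition descent_err (Y : R) : R :=
  2 * Y * inner_err B + (Gam * inner_err B + B%:R * C) ^+ 2.

Lemma sodda_update_descent (t : nat) (w ws : 'cV[R]_d) (st : sodda_draw) (Y : R) :
  0 <= gamma t.+1 -> gamma t.+1 <= Gam ->
  let mu := gradient_estimate f x (s t) w st.1.1.1 st.1.1.2 st.1.2 in
  (forall l, `|mu l 0| <= C) ->
  (forall l, `|w l 0 - ws l 0| <= Y) ->
  enorm (sodda_update t w st - ws) ^+ 2 <= enorm (w - ws) ^+ 2
    - 2 * B%:R * gamma t.+1 * (\sum_l mu l 0 * (w l 0 - ws l 0))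
    + d%:R * descent_err Y * gamma t.+1 ^+ 2.
Proof.
move=> g0 gG mu muC wY.
have -> : d%:R * descent_err Y * gamma t.+1 ^+ 2 =
    \sum_(l < d) descent_err Y * gamma t.+1 ^+ 2.
  by rewrite sumr_const card_ord -[RHS]mulr_natl mulrA.
rewrite !sqr_enorm mulr_sumr -sumrB -big_split/=; apply: ler_sum => l _.
have := sodda_update_le l g0 gG muC;
  rewrite -/mu ![(_ - ws) _ _]mxE ![(- ws) _ _]mxE.
set g := gamma _ in g0 gG *; set v := sodda_update _ _ _ _ _; set a := w l 0.
set u := mu l 0; set E := inner_err B.
set r := v - a + _ => rE.
have Y0 : 0 <= Y by exact: le_trans (wY l).
have E0 : 0 <= E by apply: inner_err_ge0; exact: le_trans gG.
have -> : v - ws l 0 = (a - ws l 0) - g * B%:R * u + r by rewrite /r; ring.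
have := wY l; have uC := muC l; rewrite -/a -/u in uC *.
move: (a - ws l 0) => y yY.
have yr : y * r <= Y * (g ^+ 2 * E).
  by apply: (le_trans (ler_norm _)); rewrite normrM ler_pM.
have sq : (r - g * B%:R * u) ^+ 2 <= (g * (Gam * E + B%:R * C)) ^+ 2.
  rewrite -[leLHS]real_normK ?num_real// ler_pXn2r ?nnegrE//; last first.
    by rewrite mulr_ge0// addr_ge0 ?mulr_ge0// (le_trans g0).
  apply: (le_trans (ler_normB _ _)); rewrite mulrDr lerD//.
    by apply: (le_trans rE); rewrite expr2 -mulrA ler_wpM2l// ler_wpM2r.
  by rewrite !normrM (ger0_norm g0) ger0_norm// -mulrA !ler_wpM2l.
rewrite /descent_err -/E; move: yr sq; rewrite !exprMn.
set z := (Gam * E + _) ^+ 2 => yr sq.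
have -> : (y - g * B%:R * u + r) ^+ 2 = y ^+ 2 - 2 * B%:R * g * (u * y) +
   (2 * (y * r) + (r - g * B%:R * u) ^+ 2) by ring.
rewrite lerD2l; lra.
Qed.

End update.

(** * Independence of the draws and the drift inequality *)

Lemma fin_preimage_measurable (disp : measure_display) (T : measurableType disp)
    (J : finType) (Z : T -> J) (D : set J) :
  (forall j, measurable [set o | Z o = j]) -> measurable [set o | D (Z o)].
Proof.
move=> mZ; rewrite (_ : mkset _ = \bigcup_(j in D) [set o | Z o = j]).
  by apply: fin_bigcup_measurable => //; exact: finite_finset.
by rewrite predeqE => o; split => [Do|[j Dj /= ->]//]; exists (Z o).
Qed.

(** A point of a nonempty cylinder names the past values time by time, which exposes the cylinder as
    an intersection over times, ready for independence. *)
Lemma cylinderE (T St : Type) (Y : nat -> T -> St) (h : seq St) (o0 : T) :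
  cylinder Y h o0 ->
  cylinder Y h = [set o | forall t, (t < size h)%N -> Y t o = Y t o0].
Proof.
elim: h => [_|st h IH [/= ho Yo]] /=; first by rewrite predeqE.
rewrite IH// predeqE => o; split => [[ht Yo'] t|ht].
  by rewrite ltnS leq_eqVlt => /predU1P[->|/ht//]; rewrite Yo.
by split => [t th|]; [apply: ht; rewrite ltnS ltnW|rewrite -Yo; apply: ht].
Qed.

Lemma mutually_independent_fin (disp : measure_display)
    (T : measurableType disp) (R : realType) (Pr : probability T R) (I : Type)
    (E0 : I -> set (set T)) (K : finType) (idx : K -> I) (E : K -> set T) :
  mutually_independent Pr E0 -> injective idx -> (forall a, E0 (idx a) (E a)) ->
  Pr (\bigcap_(a in [set: K]) E a) = (\prod_a Pr (E a))%E.
Proof.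
move=> ind idxI EE.
rewrite (reindex (enum_val : 'I_#|K| -> K)) /=; last exact/onW_bij/enum_val_bij.
rewrite -(ind _ (idx \o enum_val) (E \o enum_val)) //=; last first.
  by move=> a b /idxI /enum_val_inj.
congr (Pr _); rewrite predeqE => o; split => h a _ /=; first exact: h.
by rewrite -(enum_rankK a); exact: h.
Qed.

Section draws.
Context {T : Type} {N d P Q B : nat}.
Variable S : sodda_draws T N d P Q B.

Definition draw_value (t : nat) (o : T) : @sodda_draw N d P Q B :=
  ((draw_B S t o, draw_C S t o, draw_D S t o),
   ([ffun q => draw_perm S t q o],
    [ffun a : 'I_P * 'I_Q * 'I_B => draw_pick S t a.1.1 a.1.2 a.2 o])).

Definition draw_agree (st : @sodda_draw N d P Q B) (i : draw_idx P Q B) : set T :=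
  match i with
  | FeatureDraw t => [set o | (draw_B S t o, draw_C S t o) = st.1.1]
  | ObservationDraw t => [set o | draw_D S t o = st.1.2]
  | PermDraw t q => [set o | draw_perm S t q o = st.2.1 q]
  | PickDraw t p q i => [set o | draw_pick S t p q i o = st.2.2 (p, q, i)]
  end.

Lemma draw_agree_event st i : draw_events S i (draw_agree st i).
Proof.
case: i => [t|t|t q|t p q i] /=.
- by exists [set st.1.1] => //; rewrite setTI.
- by exists [set st.1.2] => //; rewrite setTI.
- by exists [set st.2.1 q] => //; rewrite setTI.
- by exists [set st.2.2 (p, q, i)] => //; rewrite setTI.
Qed.

(** A finite type of labels for the elementary draws of one iteration: those before time n are then
    a finite family indexed by ['I_n * draw_kind]. *)
Definition draw_kind : finType := (bool + 'I_Q + 'I_P * 'I_Q * 'I_B)%type.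

Definition draw_at (t : nat) (j : draw_kind) : draw_idx P Q B :=
  match j with
  | inl (inl true) => FeatureDraw P Q B t
  | inl (inl false) => ObservationDraw P Q B t
  | inl (inr q) => PermDraw P B t q
  | inr (p, q, i) => PickDraw t p q i
  end.

Lemma draw_at_inj t t' j j' : draw_at t j = draw_at t' j' -> t = t' /\ j = j'.
Proof.
by case: j => [[[]|q]|[[p q] i]]; case: j' => [[[]|q']|[[p' q'] i']] //= [];
  do ?[move=> ->]; move=> *; subst.
Qed.

Lemma draw_valueE t st :
  [set o | draw_value t o = st] =
  \bigcap_(j in [set: draw_kind]) draw_agree st (draw_at t j).
Proof.
rewrite predeqE => o; split => [<- [[[]|q]|[[p q] i]] _ /=|h].
- by [].
- by [].
- by rewrite ffunE.
- by rewrite ffunE.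
have h1 := h (inl (inl true)) I; have h2 := h (inl (inl false)) I.
case: st h h1 h2 => [[[Bs Cs] Ds] [pi pk]] h /= [<- <-] <-.
congr (_, (_, _)).
  by apply/ffunP => q; rewrite ffunE; exact: (h (inl (inr q)) I).
by apply/ffunP => -[[p q] i]; rewrite ffunE; exact: (h (inr (p, q, i)) I).
Qed.

Lemma sodda_iter_trajectory (R : realType) (hd : (Q * P %| d)%N) (f : 'I_N -> R -> R)
    (x : 'I_N -> 'rV[R]_d) (obs : 'I_P -> 'I_(N %/ P) -> 'I_N) (gamma : nat -> R)
    (s : nat -> nat) (t : nat) (o : T) :
  sodda_iter hd f x obs gamma s S t o =
  trajectory draw_value 0 (sodda_update hd f x obs gamma s) t o.
Proof.
elim: t => [//|t IH]; rewrite [LHS]/= IH [RHS]/=.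
set w := trajectory _ _ _ _ _; clearbody w.
rewrite /sodda_update; apply: (f_equal (concat_subblocks hd)).
apply/funext => q; apply/funext => k.
have -> : (draw_value t o).2.1 q = draw_perm S t q o by rewrite ffunE.
apply: (f_equal (foldl _ _)); apply: eq_map => i.
by rewrite ffunE.
Qed.

End draws.

Section draw_law.
Context {disp : measure_display} {T : measurableType disp} {R : realType}
  (Pr : probability T R) {N d P Q B : nat}.
Variables (b c s : nat -> nat) (S : sodda_draws T N d P Q B).
Hypothesis hS : sodda_sampling Pr b c s S.
Local Notation draw_value := (draw_value S).
Local Notation draw_agree := (draw_agree S).
Local Notation draw_kind := (@draw_kind P Q B).

Lemma draw_value_measurable t st : measurable [set o | draw_value t o = st].
Proof.
have [mS _ _ _ _] := hS; rewrite draw_valueE.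
apply: fin_bigcap_measurable => [|j _]; first exact: finite_finset.
exact/mS/draw_agree_event.
Qed.

(** Independence is used twice: to split the joint event into elementary draws, and backwards to
    reassemble those of the past into the cylinder. *)
Lemma cylinder_draw (h : seq (@sodda_draw N d P Q B)) v :
  fine (Pr (cylinder draw_value h `&` [set o | (draw_value (size h) o).1 = v])) =
  fine (Pr (cylinder draw_value h)) *
    draw_weight (b (size h)) (c (size h)) (s (size h)) v.
Proof.
have [_ hB hC hD [_ ind]] := hS.
have [->|/set0P[z0 hz0]] := eqVneq (cylinder draw_value h) set0.
  by rewrite set0I measure0 mul0r.
rewrite (cylinderE hz0); set n := size h.
pose past : finType := ('I_n * draw_kind)%type.
pose Epast (a : past) := draw_agree (draw_value a.1 z0) (draw_at a.1 a.2).
pose Enew (a : bool) := if a then [set o | (draw_B S n o, draw_C S n o) = v.1]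
                        else [set o | draw_D S n o = v.2].
pose idx (a : (past + bool)%type) := match a with
  inl a => draw_at a.1 a.2 | inr a => draw_at n (inl (inl a)) end.
pose E (a : (past + bool)%type) := match a with inl a => Epast a | inr a => Enew a end.
have idxI : injective idx.
  move=> [[t j]|a] [[t' j']|a'] /draw_at_inj /= [].
  - by move=> /val_inj -> ->.
  - by move=> tn; have := ltn_ord t; rewrite tn ltnn.
  - by move=> tn; have := ltn_ord t'; rewrite -tn ltnn.
  - by move=> _ [->].
have EE a : draw_events S (idx a) (E a).
  case: a => [a|[]]; first exact: draw_agree_event.
    by exists [set v.1] => //; rewrite setTI.
  by exists [set v.2] => //; rewrite setTI.
have pastE : [set o | forall t, (t < n)%N -> draw_value t o = draw_value t z0] =
    \bigcap_(a in [set: past]) Epast a.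
  rewrite predeqE => o; split => [hh [t j] _|hh t tn].
    have := hh t (ltn_ord t); rewrite /Epast /= => ho.
    have : [set o | draw_value t o = draw_value t z0] o by [].
    by rewrite draw_valueE; apply.
  have : [set o | draw_value t o = draw_value t z0] o; last by [].
  by rewrite draw_valueE => j _; exact: (hh (Ordinal tn, j) I).
have allE : \bigcap_(a in [set: past]) Epast a `&` [set o | (draw_value n o).1 = v] =
    \bigcap_(a in [set: (past + bool)%type]) E a.
  rewrite predeqE => o; split => [[hp hv] [a|[]] _ /=|hh].
  - exact: hp.
  - by rewrite -hv.
  - by rewrite -hv.
  split => [a _|]; first exact: (hh (inl a) I).
  have /= := hh (inr true) I; have /= := hh (inr false) I.
  by case: (v) => v1 v2 /= -> ->.
rewrite pastE allE (mutually_independent_fin ind idxI EE) big_sumType /=.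
rewrite -(mutually_independent_fin ind
  (idx := fun a : past => draw_at a.1 a.2)); last 2 first.
- by move=> [t j] [t' j'] /draw_at_inj /= [/val_inj -> ->].
- by move=> a; exact: draw_agree_event.
rewrite big_bool /= hD.
have -> : [set o | (draw_B S n o, draw_C S n o) = v.1] =
    [set o | draw_B S n o = v.1.1 /\ draw_C S n o = v.1.2].
  by case: (v.1) => v1 v2; rewrite predeqE => o; split => /= [[-> ->]|[-> ->]].
rewrite hC hB -!EFinM fineM//=.
by apply: fin_num_measure; rewrite -pastE -(cylinderE hz0);
  apply: cylinder_measurable => t st; exact: draw_value_measurable.
Qed.

Lemma sum_cylinder_draw (h : seq (@sodda_draw N d P Q B)) v :
  \sum_u fine (Pr (cylinder draw_value ((v, u) :: h))) =
  fine (Pr (cylinder draw_value h)) *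
    draw_weight (b (size h)) (c (size h)) (s (size h)) v.
Proof.
rewrite -cylinder_draw (@fine_pr_partition _ _ _ _ _ (fun o => (draw_value (size h) o).2)).
- apply: eq_bigr => u _ /=; rewrite -setIA; congr (fine (Pr (_ `&` _))).
  have pairE (y : @sodda_draw N d P Q B) : y = (v, u) <-> y.1 = v /\ y.2 = u.
    by case: y => y1 y2; split => [[-> ->]|/= [-> ->]].
  by rewrite predeqE => o; exact: pairE.
- by move=> u; apply: (fin_preimage_measurable [set st | st.2 = u]) => st;
    exact: draw_value_measurable.
apply: measurableI.
  by apply: cylinder_measurable => t st; exact: draw_value_measurable.
by apply: (fin_preimage_measurable [set st | st.1 = v]) => st;
  exact: draw_value_measurable.
Qed.

End draw_law.

Lemma fin_ubound (R : realType) (I J : finType) (u : I -> J -> R) :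
  exists2 M, 0 <= M & forall i j, `|u i j| <= M.
Proof.
exists (\sum_i \sum_j `|u i j|); first by do 2!apply: sumr_ge0 => ? _.
move=> i j; rewrite (bigD1 i)//= (bigD1 j)//= -addrA lerDl addr_ge0//.
  exact: sumr_ge0.
by do 2!apply: sumr_ge0 => ? _.
Qed.

(* The lower bound on [b t] makes the number of omitted features [O(gamma ^ 2)],
   so that the bias they cause needs no averaging. *)
Lemma missing_features_le (R : realType) (d b c : nat) (eta g M2 L : R) :
  (0 < c <= d)%N -> 0 <= eta -> 
  d%:R / (1 + 4%:R * d%:R * eta * g ^+ 2 / (c%:R * M2 ^+ 2 * L ^+ 2)) <= b%:R ->
  (b <= d)%N ->
  (d - b)%N%:R <= d%:R * (4%:R * d%:R * eta / (M2 ^+ 2 * L ^+ 2)) * g ^+ 2.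
Proof.
move=> /andP[c0 cd] eta0; set z := (X in 1 + X) => db bd.
have D0 : 0 <= (M2 ^+ 2 * L ^+ 2)^-1 by rewrite invr_ge0 mulr_ge0// sqr_ge0.
have zE : z = c%:R^-1 * (4%:R * d%:R * eta / (M2 ^+ 2 * L ^+ 2) * g ^+ 2).
  by rewrite /z -[X in _ / X]mulrA invfM; ring.
set k := _ / _ * _ in zE.
have k0 : 0 <= k.
  apply: mulr_ge0; last exact: sqr_ge0.
  apply: mulr_ge0 => //; apply: mulr_ge0 => //; exact: mulr_ge0.
have z0 : 0 <= z by rewrite zE mulr_ge0 ?invr_ge0.
have zk : z <= k.
  by rewrite zE ler_piMl// invf_le1 ?ltr0n// ler1n.
rewrite -[leRHS]mulrA -/k natrB//.
(* From d <= b (1 + z) one gets d - b <= b z <= d z <= d k. If M2 L = 0, both quotients are 0 by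
   convention and the bound says b = d. *)
move: db; rewrite ler_pdivrMr; last lra.
have bd' : (b%:R : R) <= d%:R by rewrite ler_nat.
have : b%:R * z <= d%:R * z by rewrite ler_wpM2r.
have : d%:R * z <= d%:R * k by rewrite ler_wpM2l.
lra.
Qed.

(** * The drift inequality for SODDA *)

Section drift.
Context {disp : measure_display} {T : measurableType disp} {R : realType}
  (Pr : probability T R) {N d P Q B : nat}.
Variables (b c s : nat -> nat) (S : sodda_draws T N d P Q B).
Variables (hd : (Q * P %| d)%N) (f : 'I_N -> R -> R) (x : 'I_N -> 'rV[R]_d)
  (obs : 'I_P -> 'I_(N %/ P) -> 'I_N) (gamma : nat -> R) (ws : 'cV[R]_d).
Variables (xi Lam X W F0 Gam Kb : R).
Hypothesis hS : sodda_sampling Pr b c s S.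
Hypothesis hcb : forall t, (1 <= c t <= b t)%N.
Hypothesis hbd : forall t, (b t <= d)%N.
Hypothesis hs : forall t, (1 <= s t <= N)%N.
Hypothesis d0 : (0 < d)%N.
Hypothesis df : forall i y, derivable (f i) y 1.
Hypothesis gamma0 : forall t, 0 < gamma t.+1.
Hypothesis gammaG : forall t, gamma t.+1 <= Gam.
Hypothesis xi0 : 0 < xi.
Hypothesis sc : strongly_convex xi (objective f x).
Hypothesis wsmin : forall v, objective f x ws <= objective f x v.
Hypothesis Lam0 : 0 <= Lam.
Hypothesis X0 : 0 <= X.
Hypothesis W0 : 0 <= W.
Hypothesis F00 : 0 <= F0.
Hypothesis Kb0 : 0 <= Kb.
Hypothesis fLip : forall j k u v,
  `|derive1 (f j) u - derive1 (f j) v| * `|x j 0 k| <= Lam * `|u - v|.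
Hypothesis xX : forall j k, `|x j 0 k| <= X.
Hypothesis fF : forall j k, `|derive1 (f j) 0 * x j 0 k| <= F0.
Hypothesis wsW : forall l, `|ws l 0| <= W.
Hypothesis missing : forall t, (d - b t)%N%:R <= Kb * gamma t.+1 ^+ 2.

Local Notation upd := (@sodda_update R N d P Q B hd f x obs gamma s).
Local Notation cyl := (cylinder (draw_value S)).
Local Notation st := (state 0 upd).

Definition estimate_bound := N%:R * (F0 + Lam * X * W * d%:R).

Definition drift_rate := B%:R * xi / (2%:R * d%:R).

(** The bias contributes at order gamma^3; one factor is replaced by [Gam]. *)
Definition drift_err := d%:R * @descent_err R d P Q B Lam X estimate_bound Gam (2 * W) +
  2 * B%:R * Gam * (d%:R * (2 * W) * (Lam * X * W * Kb)).

Lemma mean_descent (t : nat) (w : 'cV[R]_d) : (forall l, `|w l 0| <= W) ->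
  xi / (4%:R * d%:R) * enorm (w - ws) ^+ 2 -
    d%:R * (2 * W) * (Lam * X * W * Kb) * gamma t.+1 ^+ 2 <=
  \sum_v draw_weight (b t) (c t) (s t) v *
    \sum_l gradient_estimate f x (s t) w v.1.1 v.1.2 v.2 l 0 * (w l 0 - ws l 0).
Proof.
move=> wW; have d0' : 0 < d%:R :> R by rewrite ltr0n.
have [/andP[c1 _] bd] := (hcb t, hbd t).
pose mu l := \sum_v draw_weight (b t) (c t) (s t) v *
  gradient_estimate f x (s t) w v.1.1 v.1.2 v.2 l 0.
have -> : \sum_v draw_weight (b t) (c t) (s t) v *
    \sum_l gradient_estimate f x (s t) w v.1.1 v.1.2 v.2 l 0 * (w l 0 - ws l 0) =
    \sum_l mu l * (w l 0 - ws l 0).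
  under eq_bigr do rewrite mulr_sumr.
  rewrite exchange_big; apply: eq_bigr => l _ /=; rewrite mulr_suml.
  by apply: eq_bigr => v _; rewrite mulrA.
pose gr l := mean_gradient f x w [set: 'I_d]%SET l.
have convex : xi / 4%:R * enorm (w - ws) ^+ 2 <= \sum_l gr l * (w l 0 - ws l 0).
  apply: le_trans (strongly_convex_gradient df xi0 sc w wsmin) _.
  rewrite le_eqVlt; apply/orP; left; apply/eqP; apply: eq_bigr => l _.
  congr (_ * _ * _); apply: eq_bigr => j _; congr (_ * _); apply: f_equal.
  by rewrite mxE; apply: eq_bigl => l'; rewrite inE.
have dev l : (c t)%:R / d%:R * gr l * (w l 0 - ws l 0) -
    2 * W * (Lam * X * W * Kb) * gamma t.+1 ^+ 2 <= mu l * (w l 0 - ws l 0).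
  have := mean_estimate_le Lam0 X0 fLip xX (hcb t) bd (hs t) l wW.
  rewrite -/(mu l) -/(gr l) => h.
  have yW : `|w l 0 - ws l 0| <= 2 * W.
    by rewrite (le_trans (ler_normB _ _))// mulr2n mulrDl !mul1r lerD.
  rewrite lerBlDl -lerBlDr -mulrBl.
  apply: le_trans (ler_norm _) _; rewrite normrM distrC.
  have LXW : 0 <= Lam * X * W by rewrite !mulr_ge0.
  rewrite [leLHS]mulrC -[leRHS]mulrA ler_pM//; apply: (le_trans h).
  by rewrite -[leRHS]mulrA ler_wpM2l.
apply: le_trans (ler_sum _ (fun l _ => dev l)).
rewrite sumrB sumr_const card_ord -[X in _ <= _ - X]mulr_natl !mulrA lerB//.
under [leRHS]eq_bigr do rewrite -mulrA.
rewrite -mulr_sumr.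
(* Using only c_t >= 1 makes the contraction rate independent of t. *)
have c1d : d%:R^-1 <= (c t)%:R / d%:R :> R.
  by rewrite ler_peMl ?invr_ge0// ler1n.
have cv0 : 0 <= xi / 4%:R * enorm (w - ws) ^+ 2 by rewrite mulr_ge0 ?sqr_ge0// divr_ge0// ltW.
apply: (@le_trans _ _ (d%:R^-1 * (xi / 4%:R * enorm (w - ws) ^+ 2))).
  by rewrite le_eqVlt; apply/orP; left; apply/eqP; field; rewrite ?lt0r_neq0.
by apply: ler_pM => //; rewrite invr_ge0.
Qed.

Lemma drift_err_ge0 : 0 <= drift_err.
Proof.
have G0 : 0 <= Gam by rewrite (le_trans _ (gammaG 0))// ltW.
have C0 : 0 <= estimate_bound by rewrite !mulr_ge0// addr_ge0// !mulr_ge0.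
rewrite /drift_err /descent_err.
have := @inner_err_ge0 R d P Q Lam X estimate_bound Gam Lam0 X0 C0 B G0.
move=> E0; rewrite addr_ge0//.
  by rewrite mulr_ge0// addr_ge0 ?sqr_ge0// !mulr_ge0.
by rewrite !mulr_ge0.
Qed.

Lemma sodda_drift (h : seq (@sodda_draw N d P Q B)) :
  (fine (Pr (cyl h)) != 0 -> forall l, `|st h l 0| <= W) ->
  \sum_a fine (Pr (cyl (a :: h))) * enorm (st (a :: h) - ws) ^+ 2 <=
  fine (Pr (cyl h)) *
    (expR (- (drift_rate * gamma (size h).+1)) * enorm (st h - ws) ^+ 2 +
     drift_err * gamma (size h).+1 ^+ 2).
Proof.
move=> hW; set p := fine (Pr (cyl h)) in hW *.
have mY := draw_value_measurable hS.
(* The extensions of a null history are null, so both sides vanish. *)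
have [p0|p0] := eqVneq p 0.
  rewrite p0 mul0r big1// => a _.
  suff -> : fine (Pr (cyl (a :: h))) = 0 by rewrite mul0r.
  apply/eqP; rewrite eq_le fine_pr_ge0 andbT -p0.
  by apply: fine_pr_le; [exact: (cylinder_measurable mY (a :: h))|
    exact: cylinder_measurable|exact: subIsetl].
have {}hW := hW p0; set n := size h; set w := st h in hW *.
set g := gamma n.+1.
have g0 : 0 < g by exact: gamma0.
have gG : g <= Gam by exact: gammaG.
set V := enorm (w - ws) ^+ 2.
have V0 : 0 <= V by exact: sqr_ge0.
set D := d%:R * @descent_err R d P Q B Lam X estimate_bound Gam (2 * W).
pose phi v := \sum_l gradient_estimate f x (s n) w v.1.1 v.1.2 v.2 l 0 *
  (w l 0 - ws l 0).
have C0 : 0 <= estimate_bound by rewrite !mulr_ge0// addr_ge0// !mulr_ge0.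
have wY l : `|w l 0 - ws l 0| <= 2 * W.
  by rewrite (le_trans (ler_normB _ _))// mulr2n mulrDl !mul1r lerD.
have step a : enorm (st (a :: h) - ws) ^+ 2 <=
    V + D * g ^+ 2 - 2 * B%:R * g * phi a.1.
  rewrite addrAC; apply: sodda_update_descent => //; first exact: ltW.
  by move=> l; apply: gradient_estimate_le => //; case/andP: (hs n).
apply: (@le_trans _ _ (\sum_a fine (Pr (cyl (a :: h))) *
    (V + D * g ^+ 2 - 2 * B%:R * g * phi a.1))).
  by apply: ler_sum => a _; rewrite ler_wpM2l ?fine_pr_ge0.
under eq_bigr do rewrite mulrBr.
rewrite sumrB -mulr_suml (sum_cylinder _ mY) -/p.
rewrite [X in _ - X](_ : _ = p * (2 * B%:R * g *
    \sum_v draw_weight (b n) (c n) (s n) v * phi v)); last first.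
  transitivity (\sum_v \sum_u fine (Pr (cyl ((v, u) :: h))) * (2 * B%:R * g * phi v)).
    by rewrite pair_bigA; apply: eq_bigr => -[v u] _.
  rewrite !mulr_sumr.
  apply: eq_bigr => v _; rewrite -mulr_suml (sum_cylinder_draw hS) -/p; ring.
rewrite -mulrBr ler_wpM2l ?fine_pr_ge0//.
have := mean_descent n hW; rewrite -/V -/g -/phi.
set Phi := \sum_v _ => hPhi.
have e1 : (1 - drift_rate * g) * V <= expR (- (drift_rate * g)) * V.
  by rewrite ler_wpM2r// expR_ge1Dx.
have Bg0 : 0 <= 2 * B%:R * g by rewrite !mulr_ge0// ltW.
have h1 := ler_wpM2l Bg0 hPhi.
have d0' : d%:R != 0 :> R by rewrite pnatr_eq0 -lt0n.
have rE : 2 * B%:R * g * (xi / (4%:R * d%:R) * V) = drift_rate * g * V.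
  by rewrite /drift_rate; field.
set E2 := d%:R * (2 * W) * (Lam * X * W * Kb) in h1.
have E20 : 0 <= 2 * B%:R * E2 * g ^+ 2.
  by rewrite mulr_ge0 ?sqr_ge0// !mulr_ge0.
have gg : g * (2 * B%:R * E2 * g ^+ 2) <= Gam * (2 * B%:R * E2 * g ^+ 2).
  by rewrite ler_wpM2r.
rewrite /drift_err -/D -/E2; move: h1; rewrite mulrBr rE; lra.
Qed.

End drift.

Theorem theorem5 (R : realType) (disp : measure_display)
    (T : measurableType disp) (Pr : probability T R)
    (N d P Q B : nat)
    (hN0 : (0 < N)%N) (hd0 : (0 < d)%N) (hP0 : (0 < P)%N) (hQ0 : (0 < Q)%N)
    (hB0 : (1 <= B)%N)
    (hN : (P %| N)%N) (hd : (Q * P %| d)%N)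
    (x : 'I_N -> 'rV[R]_d) (f : 'I_N -> R -> R)
    (hf : forall (i : 'I_N) (y : R), derivable (f i) y 1)
    (obs : 'I_P -> 'I_(N %/ P) -> 'I_N)
    (hobs : bijective (fun pj : 'I_P * 'I_(N %/ P) => obs pj.1 pj.2))
    (ws : 'cV[R]_d) (hws : unique_minimizer (objective f x) ws)
    (b c s : nat -> nat)
    (hcb : forall t, (1 <= c t <= b t)%N) (hbd : forall t, (b t <= d)%N)
    (hs : forall t, (1 <= s t <= N)%N)
    (gamma : nat -> R) (hgamma : forall t, (1 <= t)%N -> 0 < gamma t)
    (S : sodda_draws T N d P Q B) (hS : sodda_sampling Pr b c s S)
    (xi : R) (hxi : 0 < xi) (hF : strongly_convex xi (objective f x))
    (L : R) (hL : 1 <= L)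
    (hLip : forall (i : 'I_N) (w w' : 'cV[R]_d),
      enorm (gradient (linear_loss (f i) (x i)) w -
             gradient (linear_loss (f i) (x i)) w') <= L * enorm (w - w'))
    (G : R)
    (hG : {ae Pr, forall o, forall t : nat,
      let w := sodda_iter hd f x obs gamma s S t o in
      (N%:R - 1)^-1 *
        \sum_(j < N) (enorm (gradient (linear_loss (f j) (x j)) w) ^+ 2 -
                      enorm (gradient (objective f x) w) ^+ 2) <= G ^+ 2})
    (M2 : R)
    (hM : {ae Pr, forall o, forall t : nat,
      enorm (sodda_iter hd f x obs gamma s S t o) <= M2 / 2%:R})
    (hMs : enorm ws <= M2 / 2%:R)
    (hgamma1 : (\sum_(1 <= t <oo) (gamma t)%:E = +oo)%E)
    (hgamma2 : (\sum_(1 <= t <oo) ((gamma t) ^+ 2)%:E < +oo)%E)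
    (eta : R) (heta : 0 <= eta)
    (hb : forall t : nat,
      Num.max ((c t)%:R : R)
        (d%:R / (1 + 4%:R * d%:R * eta * gamma t.+1 ^+ 2 /
                     ((c t)%:R * M2 ^+ 2 * L ^+ 2)))
      <= (b t)%:R <= (d%:R : R)) :
  {ae Pr, forall o,
    (fun t : nat => enorm (sodda_iter hd f x obs gamma s S t o - ws))
      @ \oo --> (0 : R)}.
Proof.
pose W := M2 / 2%:R.
have W0 : 0 <= W by apply: le_trans hMs; exact: enorm_ge0.
have gamma0 t : 0 < gamma t.+1 by exact: hgamma.
have [Lam Lam0 hLam] := fin_ubound (fun j k => L / enorm (x j)^T ^+ 2 * `|x j 0 k|).
have [X X0 xX] := fin_ubound (fun j k => x j 0 k).
have [F0 F00 fF] := fin_ubound (fun j k => derive1 (f j) 0 * x j 0 k).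
have fLip j k u v :
    `|derive1 (f j) u - derive1 (f j) v| * `|x j 0 k| <= Lam * `|u - v|.
  apply: le_trans (derive1_lipschitz (hf j) (hLip j) k u v) _.
  by rewrite ler_wpM2r// (le_trans (ler_norm _)).
(* Taken with K = 1 merely to bound the learning rates: gamma^2 is at most the total [tau1 0], and
   gamma <= 1 + gamma^2. *)
have [tau1 [tau10 tau1S _]] := square_tail ler01 hgamma2.
pose Gam := 1 + tau1 0%N.
have gammaG t : gamma t.+1 <= Gam.
  have tau1le n : tau1 n <= tau1 0%N.
    elim: n => // n; apply: le_trans; apply: le_trans (tau1S n).
    by rewrite lerDr mul1r sqr_ge0.
  have := tau1S t; have := tau10 t.+1; have := tau1le t; rewrite mul1r /Gam.
  have := sqr_ge0 (gamma t.+1 - 1); nra.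
pose Kb := d%:R * (4%:R * d%:R * eta / (M2 ^+ 2 * L ^+ 2)).
have Kb0 : 0 <= Kb.
  apply: mulr_ge0 => //; apply: divr_ge0; first by rewrite !mulr_ge0.
  by apply: mulr_ge0; exact: sqr_ge0.
have missing t : (d - b t)%N%:R <= Kb * gamma t.+1 ^+ 2.
  apply: (@missing_features_le _ _ _ (c t)) => //.
    by have /andP[-> cb] := hcb t; exact: leq_trans cb (hbd t).
  by have /andP[] := hb t; rewrite ge_max => /andP[].
have wsW l : `|ws l 0| <= W by exact: le_trans (normr_le_enorm _ _) hMs.
have wsmin : forall v, objective f x ws <= objective f x v by case: hws.
pose upd := @sodda_update R N d P Q B hd f x obs gamma s.
have mY := draw_value_measurable hS.
pose err := @drift_err R N d P Q B Lam X W F0 Gam Kb.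
pose rate := @drift_rate R d B xi.
have err0 : 0 <= err by exact: (drift_err_ge0 gamma0 gammaG).
have rate0 : 0 < rate by rewrite /rate /drift_rate divr_gt0// mulr_gt0 ?ltr0n.
have [tau [tau0 tauS tau_cvg]] := square_tail err0 hgamma2.
pose rho n := expR (- (rate * gamma n.+1)).
have rho01 n : 0 <= rho n <= 1.
  by rewrite expR_ge0 -expR0 ler_expR oppr_le0 mulr_ge0 ?ltW.
(* The iterate is constant on a cylinder: if it violated the bound there, the whole cylinder would
   lie in the exceptional null set of [hM]. *)
have bounded h : fine (Pr (cylinder (draw_value S) h)) != 0 ->
    forall l, `|state 0 upd h l 0| <= W.
  move=> ph l; apply: contrapT => nW; move/negP: ph; apply; apply/eqP.
  have mh := cylinder_measurable mY h.
  suff -> : Pr (cylinder (draw_value S) h) = 0%E by [].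
  apply/negligibleP => //; apply: negligibleS hM => o ho /= hw.
  apply: nW; rewrite -(trajectory_cylinder _ _ ho) -sodda_iter_trajectory.
  exact: le_trans (normr_le_enorm _ _) (hw (size h)).
have V0 (w : 'cV[R]_d) : 0 <= enorm (w - ws) ^+ 2 by exact: sqr_ge0.
have e0 n : 0 <= err * gamma n.+1 ^+ 2 by rewrite mulr_ge0// sqr_ge0.
have pot : potential rho (fun n => err * gamma n.+1 ^+ 2) tau 0 k
    (enorm (0 - ws) ^+ 2) @[k --> \oo] --> (0 : R).
  by apply: potential_cvg0 => // n; exact: prod_expR_cvg0.
have drift h := sodda_drift hS hcb hbd hs hd0 hf gamma0 gammaG hxi hF wsmin
  Lam0 X0 W0 F00 Kb0 fLip xX fF wsW missing (bounded h).
have := trajectory_cvg0 mY V0 rho01 tau0 tauS drift pot.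
apply: negligibleS => o /= nc hc; apply: nc.
(* The convergence obtained is that of the squared distance, hence the threshold eps^2. *)
apply/cvgrPdist_lt => eps eps0;
  move/cvgrPdist_lt: hc => /(_ _ (exprn_gt0 2 eps0)).
apply: filterS => t; rewrite !sub0r !normrN !ger0_norm ?enorm_ge0 ?V0//.
rewrite sodda_iter_trajectory ltr_pXn2r ?nnegrE ?enorm_ge0// ltW//.
Qed.
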